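(* The bialgebra $\mathcal{T}op$ is isomorphic to a shuffle twisted bialgebra $(\cot(\mathcal{Q}),\sqcup\!\sqcup,\Delta)$ for some species $\mathcal{Q}$.
   Context: $\mathcal{T}op[A]$ is the vector space generated by finite topologies (quasi-posets) on $A$; it is a twisted bialgebra with product disjoint union and coproduct $\Delta_{A,B}(T)=T_{\mid A}\otimes T_{\mid B}$ if $B$ is an open set (upward-closed set) of $T$, $0$ otherwise. For a species $\mathcal{Q}$ with $\mathcal{Q}[\emptyset]=(0)$, $\cot(\mathcal{Q})[A]=\bigoplus_{(A_1,\ldots,A_k)}\mathcal{Q}[A_1]\otimes\cdots\otimes\mathcal{Q}[A_k]$ (sum over set compositions of $A$) with deconcatenation coproduct $\Delta$, and the shuffle product $\sqcup\!\sqcup$ is $x_1\ldots x_k\,\sqcup\!\sqcup\,x_{k+1}\ldots x_{k+l}=\sum_\sigma x_{\sigma^{-1}(1)}\ldots x_{\sigma^{-1}(k+l)}$ over permutations $\sigma$ of $\{1,\ldots,k+l\}$ increasing on $\{1,\ldots,k\}$ and on $\{k+1,\ldots,k+l\}$.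
   Formalization: The base field is assumed to have characteristic zero (in characteristic p the claim fails: on coinvariants, p-th powers vanish in a shuffle algebra but not for topologies), and species are taken on finite subsets of the natural numbers, which is equivalent to all finite sets. *)

(* Defs.v *)
(* Species and twisted bialgebras are encoded on finite subsets of nat
   ({fset nat}), with all linear maps given by their matrices on bases. *)
From HB Require Import structures.
From mathcomp Require Import all_boot all_order all_algebra all_fingroup.
From mathcomp Require Import finmap.
From mathcomp Require Import boolp classical_sets fsbigop.

Set Implicit Arguments.
Unset Strict Implicit.
Unset Printing Implicit Defensive.
Import GRing.Theory.

Local Open Scope ring_scope.

(* A letter (B, j) is the j-th basis vector of Q[B] (basis of Q[B] indexed by
   j < d #|B|).  A word (B_1,j_1)...(B_k,j_k) on A, with (B_1,...,B_k) a set
   composition of A, is a basis vector of Q[B_1] (x) ... (x) Q[B_k], hence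
   these words form a basis of cot(Q)[A]. *)
Definition letter := ({fset nat} * nat)%type.
Definition word := seq letter.

Definition is_word (d : nat -> nat) (A : {fset nat}) (w : word) : Prop :=
  [/\ (forall l, l \in w -> l.1 != fset0 /\ (l.2 < d #|` l.1|)%N),
      pairwise (fun l l' : letter => [disjoint l.1 & l'.1]%fset) w &
      (\bigcup_(l <- w) l.1)%fset = A].

Definition words (d : nat -> nat) (A : {fset nat}) : set word :=
  [set w | is_word d A w].

(* A finite topology (quasi-order) on A: (x,y) \in T means x <=_T y. *)
Definition is_topology (A : {fset nat}) (T : {fset (nat * nat)}) : Prop :=
  [/\ (forall p, p \in T -> (p.1 \in A) && (p.2 \in A)),
      (forall x, x \in A -> (x, x) \in T) &
      (forall x y z, (x, y) \in T -> (y, z) \in T -> (x, z) \in T)].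

Definition topologies (A : {fset nat}) : set {fset (nat * nat)} :=
  [set T | is_topology A T].

Definition is_open (T : {fset (nat * nat)}) (B : {fset nat}) : Prop :=
  forall x y, (x, y) \in T -> x \in B -> y \in B.

Definition restr (T : {fset (nat * nat)}) (A : {fset nat}) : {fset (nat * nat)} :=
  [fset p in T | (p.1 \in A) && (p.2 \in A)]%fset.

Definition fimage (s : nat -> nat) (A : {fset nat}) : {fset nat} :=
  [fset s x | x in A]%fset.

Definition transport (s : nat -> nat) (T : {fset (nat * nat)}) : {fset (nat * nat)} :=
  [fset (s p.1, s p.2) | p in T]%fset.

Section Cot.
Variable K : fieldType.

(* A species Q of finite-dimensional K-vector spaces on finite subsets of nat:
   Q[A] has basis e_0..e_{d #|A| - 1}; for s injective on A,
   Q[s] : Q[A] -> Q[s(A)] sends e_i to \sum_j rho A s i j e_j. *)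
Definition is_species (d : nat -> nat)
    (rho : {fset nat} -> (nat -> nat) -> nat -> nat -> K) : Prop :=
  [/\ d 0 = 0%N,
      (forall A i j, (i < d #|` A|)%N -> (j < d #|` A|)%N ->
         rho A id i j = (i == j)%:R),
      (forall A (s t : nat -> nat), {in A &, injective s} ->
         {in fimage s A &, injective t} ->
         forall i k, (i < d #|` A|)%N -> (k < d #|` fimage (t \o s) A|)%N ->
         rho A (t \o s) i k =
           \sum_(j < d #|` fimage s A|) rho A s i j * rho (fimage s A) t j k) &
      (forall A (s s' : nat -> nat), {in A, s =1 s'} ->
         forall i j, rho A s i j = rho A s' i j)].

(* matrix of cot(Q)[s] : cot(Q)[A] -> cot(Q)[s(A)] on the word bases *)
Definition cot_act (rho : {fset nat} -> (nat -> nat) -> nat -> nat -> K)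
    (s : nat -> nat) (w w' : word) : K :=
  if (size w == size w') && all (fun p : letter * letter => p.2.1 == fimage s p.1.1) (zip w w')
  then \prod_(p <- zip w w') rho p.1.1 s p.1.2 p.2.2 else 0.

End Cot.

(* The shuffle product, literally: x_1..x_k  ш  x_{k+1}..x_{k+l}
   = sum over s in S_{k+l} increasing on {1..k} and on {k+1..k+l}
   of x_{s^-1(1)} ... x_{s^-1(k+l)}.  shuffle_coef u v w is the coefficient
   of the word w in u ш v. *)
Definition is_shuffle_perm (k l : nat) (s : 'S_(k + l)) : bool :=
  [forall i : 'I_(k + l), forall j : 'I_(k + l),
     (((i < j)%N && (j < k)%N) || ((k <= i)%N && (i < j)%N)) ==> (s i < s j)%N].

Definition shuffle_word (u v : word) (s : 'S_(size u + size v)) : word :=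
  [seq nth (fset0, 0%N) (u ++ v) ((s^-1)%g i) | i <- enum 'I_(size u + size v)].

Definition shuffle_coef (u v w : word) : nat :=
  #|[set s : 'S_(size u + size v) | is_shuffle_perm s && (shuffle_word s == w)]|.

Section Iso.
Variable K : fieldType.
Local Open Scope classical_set_scope.

(* f A T w = coefficient of the word w in f_A(T), for T a topology on A.
   The predicate says that (f_A)_A is an isomorphism of twisted bialgebras
   from (Top, disjoint union, Delta) to (cot(Q), shuffle, deconcatenation). *)
Definition top_cot_iso (d : nat -> nat)
    (rho : {fset nat} -> (nat -> nat) -> nat -> nat -> K)
    (f : {fset nat} -> {fset (nat * nat)} -> word -> K) : Prop :=
  (forall A T w, is_topology A T -> f A T w != 0 -> is_word d A w) /\
  [/\
      (exists g : {fset nat} -> word -> {fset (nat * nat)} -> K,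
        [/\ (forall A w T, is_word d A w -> g A w T != 0 -> is_topology A T),
            (forall A T T', is_topology A T -> is_topology A T' ->
               \sum_(w \in words d A) f A T w * g A w T' = (T == T')%:R) &
            (forall A w w', is_word d A w -> is_word d A w' ->
               \sum_(T \in topologies A) g A w T * f A T w' = (w == w')%:R)]),
      (forall A (s : nat -> nat) T w', {in A &, injective s} ->
         is_topology A T -> is_word d (fimage s A) w' ->
         f (fimage s A) (transport s T) w' =
           \sum_(w \in words d A) f A T w * cot_act rho s w w'),
      (forall A B T1 T2 w, [disjoint A & B]%fset ->
         is_topology A T1 -> is_topology B T2 -> is_word d (A `|` B)%fset w ->
         f (A `|` B)%fset (T1 `|` T2)%fset w =
           \sum_(w1 \in words d A) \sum_(w2 \in words d B)
              f A T1 w1 * f B T2 w2 * (shuffle_coef w1 w2 w)%:R),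
      (forall A B T w1 w2, [disjoint A & B]%fset ->
         is_topology (A `|` B)%fset T -> is_word d A w1 -> is_word d B w2 ->
         f (A `|` B)%fset T (w1 ++ w2) =
           (if `[< is_open T B >] then f A (restr T A) w1 * f B (restr T B) w2
            else 0)) &
      f fset0 fset0 [::] = 1].

End Iso.

(* Main.v *)
(* Take for Q[A] the span of the topologies on A (nonempty) that are not ordinal
   sums of two smaller ones. The Dynkin operator D, the convolution product of
   the antipode and of the derivation Y multiplying Top[A] by #|A|, vanishes on
   products of nonempty topologies, Top being commutative, and multiplies
   primitive elements of Top[A] by #|A|. Let pi be D followed by the projection
   onto Q which kills ordinal sums, and f the coalgebra morphism from Top to
   cot(Q) with components pi (x) ... (x) pi applied to the iterated coproducts.
   As pi vanishes on products, f is a morphism to the shuffle algebra. It is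
   injective since pi is injective on primitive elements, in characteristic 0;
   and cot(Q)[A] is not larger than Top[A], since a topology has at most one
   decomposition as an ordinal sum of indecomposable ones. *)
Require Import Defs.
From HB Require Import structures.
From mathcomp Require Import all_boot all_order all_algebra all_fingroup.
From mathcomp Require Import finmap.
From mathcomp Require Import boolp classical_sets fsbigop cardinality.

Set Implicit Arguments.
Unset Strict Implicit.
Unset Printing Implicit Defensive.
Import GRing.Theory.

Local Open Scope fset_scope.
Local Open Scope ring_scope.

Implicit Types (A B C : {fset nat}) (S T : {fset (nat * nat)}) (w u v : word).
Implicit Types (l : letter) (s t : nat -> nat).

(** Primitive elements are the canonical choice for Q, but they have no evident basis, and a species
    is given here by matrices. Irreducible topologies form a basis that relabelings permute, so
    every naturality statement reduces to a bijection between index sets.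

    The Dynkin operator is best known on cocommutative bialgebras, where it takes primitive values.
    The dual property, vanishing on products, is what a commutative bialgebra offers and what the
    shuffle product asks for: otherwise letters straddling two factors would survive, as in a
    quasi-shuffle product. The antipode is never built: Id * D = Y determines D by recursion on the
    set, and this one equation yields both properties of D. Unlike an Eulerian idempotent, D has no
    denominators; the only division, by #|A|, occurs in the proof of injectivity. *)

Notation rel_on A T := (T `<=` A `*` A)%fset.

(** * Relations on a finite set and their restrictions *)

Lemma rel_onP A T :
  reflect (forall x y, (x, y) \in T -> x \in A /\ y \in A) (rel_on A T).
Proof.
apply: (iffP idP) => [/fsubsetP TA x y /TA | TA].
  by rewrite in_fsetM => /andP[].
by apply/fsubsetP => -[x y] /TA[xA yA]; rewrite in_fsetM xA.
Qed.

Lemma rel_onS A B T : A `<=` B -> rel_on A T -> rel_on B T.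
Proof.
move=> /fsubsetP AB /rel_onP TA; apply/rel_onP => x y /TA[xA yA].
by rewrite !AB.
Qed.

(** The Dynkin operator and the compatibilities of f are stated for arbitrary relations on [A], so
    that the unions and restrictions in the recursion carry no other side condition. *)
Lemma topology_rel_on A T : is_topology A T -> rel_on A T.
Proof. by case=> TA _ _; apply/rel_onP => x y /TA /andP. Qed.

Lemma in_restr T A p : (p \in restr T A) = [&& p \in T, p.1 \in A & p.2 \in A].
Proof. by rewrite !inE. Qed.

Lemma restr_on T A : rel_on A (restr T A).
Proof. by apply/rel_onP => x y; rewrite in_restr => /and3P[]. Qed.

Lemma restr_id A T : rel_on A T -> restr T A = T.
Proof.
move/rel_onP=> TA; apply/fsetP => -[x y]; rewrite in_restr /=.
by have [/TA[-> ->]|] := boolP ((x, y) \in T).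
Qed.

Lemma restr0 T : restr T fset0 = fset0.
Proof. by apply/fsetP => -[x y]; rewrite in_restr /= !inE andbF. Qed.

Lemma restr_restr T A B : B `<=` A -> restr (restr T A) B = restr T B.
Proof.
move/fsubsetP=> BA; apply/fsetP => -[x y]; rewrite !in_restr /=.
have [/BA->|] := boolP (x \in B); last by rewrite !andbF.
by have [/BA->|] := boolP (y \in B); rewrite ?andbT ?andbF.
Qed.

Lemma restrU T S A : restr (T `|` S) A = restr T A `|` restr S A.
Proof. by apply/fsetP => p; rewrite !(in_fsetU, in_restr) andb_orl. Qed.

Lemma restr_disj A B T : rel_on B T -> [disjoint A & B] -> restr T A = fset0.
Proof.
move=> /rel_onP TB /fdisjointP AB; apply/fsetP => -[x y].
rewrite in_restr in_fset0 /=; apply/negP => /and3P[/TB[xB _] /AB].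
by rewrite xB.
Qed.

Lemma restrI A B T : rel_on A T -> restr T (A `&` B) = restr T B.
Proof.
move/rel_onP=> TA; apply/fsetP => -[x y]; rewrite !in_restr !in_fsetI /=.
by have [/TA[-> ->]|] := boolP ((x, y) \in T).
Qed.

Lemma topology_restr A B T :
  is_topology A T -> B `<=` A -> is_topology B (restr T B).
Proof.
move=> [TA rT tT] /fsubsetP BA; split.
- by move=> [x y]; rewrite in_restr => /andP[].
- by move=> x xB; rewrite in_restr /= xB rT ?BA.
move=> x y z; rewrite !in_restr /= => /and3P[xy xB _] /and3P[yz _ zB].
by rewrite xB zB (tT x y z).
Qed.

(** * The Dynkin operator *)

Section Dynkin.
Variable K : fieldType.
Implicit Types (phi psi : {fset (nat * nat)} -> K).

(* [Dynkin_rec n A T phi] is the value of the linear form [phi] at D(T), for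
   [n >= #|A|]; pairing with a form keeps the recursion free of bases. *)
Fixpoint Dynkin_rec n A T phi : K :=
  if n is n'.+1 then
    #|` A|%:R * phi T - \sum_(B <- fpowerset A | (B != A) && `[< is_open T B >])
      Dynkin_rec n' B (restr T B) (fun S => phi (restr T (A `\` B) `|` S))
  else 0.

Definition Dynkin A := Dynkin_rec #|` A| A.

Lemma proper_card A B : B \in fpowerset A -> B != A -> (#|` B| < #|` A|)%N.
Proof.
by rewrite fpowersetE => BA nBA; apply: fproper_ltn_card; rewrite fproperEneq nBA.
Qed.

(** Recursive calls are at proper subsets, so fuel beyond the cardinality changes nothing. *)
Lemma Dynkin_recE n A T phi : (#|` A| <= n)%N ->
  Dynkin_rec n A T phi = Dynkin A T phi.
Proof.
rewrite /Dynkin; elim/ltn_ind: n A T phi => n IH A T phi An.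
have [A0|A0] := eqVneq A fset0.
  rewrite A0 cardfs0; case: n {IH An} => //= n.
  rewrite mul0r fpowerset0 big_mkcond big_seq_fset1 eqxx /=.
  by rewrite subrr.
have : (0 < #|` A|)%N by rewrite cardfs_gt0.
case: n An IH => [|n]; first by case: #|` A|.
case EA: #|` A| => [//|m] /= mn IH _; rewrite EA; congr (_ - _).
rewrite [LHS]big_seq_cond [RHS]big_seq_cond.
apply: eq_bigr => B /and3P[BA nBA _].
have := proper_card BA nBA; rewrite EA ltnS => Bm.
by rewrite (IH n) ?(IH m) //; exact: leq_trans Bm mn.
Qed.

Lemma DynkinE A T phi :
  Dynkin A T phi = #|` A|%:R * phi T -
    \sum_(B <- fpowerset A | (B != A) && `[< is_open T B >])
      Dynkin B (restr T B) (fun S => phi (restr T (A `\` B) `|` S)).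
Proof.
rewrite -(@Dynkin_recE #|` A|.+1) //=; congr (_ - _).
rewrite [LHS]big_seq_cond [RHS]big_seq_cond.
apply: eq_bigr => B /and3P[BA nBA _].
by rewrite Dynkin_recE // ltnW // proper_card.
Qed.

Lemma Dynkin0 T phi : Dynkin fset0 T phi = 0.
Proof. by rewrite /Dynkin cardfs0. Qed.

Lemma open_setT A T : rel_on A T -> is_open T A.
Proof. by move/rel_onP => TA x y /TA[]. Qed.

(* Id * D = Y for the convolution product, Y multiplying by the cardinality. *)
Lemma sum_Dynkin A T phi : rel_on A T ->
  \sum_(B <- fpowerset A | `[< is_open T B >])
      Dynkin B (restr T B) (fun S => phi (restr T (A `\` B) `|` S))
  = #|` A|%:R * phi T.
Proof.
move=> TA; rewrite big_mkcond (bigD1_seq A) ?fset_uniq ?fpowersetE //=.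
rewrite ifT; last by apply/asboolP/open_setT.
rewrite -big_mkcondr restr_id // fsetDv restr0.
have -> : (fun S => phi (fset0 `|` S)) = phi.
  by apply/funext => S; rewrite fset0U.
by rewrite DynkinE subrK.
Qed.

(** Forms are compared on relations on [A] only, because facts such as the injectivity of
    [transport] hold only there. *)
Lemma Dynkin_ext A T phi psi : rel_on A T ->
  (forall S, rel_on A S -> phi S = psi S) -> Dynkin A T phi = Dynkin A T psi.
Proof.
rewrite /Dynkin; move: #|` A| => n; elim: n A T phi psi => //= n IH A T phi psi TA E.
rewrite E //; congr (_ - _); rewrite [LHS]big_seq_cond [RHS]big_seq_cond.
apply: eq_bigr => B /and3P[BA _ _]; apply: IH; first exact: restr_on.
move=> S SB; apply: E; rewrite fpowersetE in BA; rewrite fsubUset.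
by rewrite (rel_onS (fsubsetDl A B)) ?restr_on // (rel_onS BA).
Qed.

Lemma restr_disjU A1 A2 T1 T2 B : [disjoint A1 & A2] -> rel_on A2 T2 ->
  B `<=` A1 -> restr (T1 `|` T2) B = restr T1 B.
Proof.
move=> A12 T2A BA; rewrite restrU (restr_disj T2A) ?fsetU0 //.
exact: fdisjointWl A12.
Qed.

Lemma is_openU A1 A2 T1 T2 B : [disjoint A1 & A2] -> rel_on A2 T2 ->
  B `<=` A1 -> is_open (T1 `|` T2) B <-> is_open T1 B.
Proof.
move=> /fdisjointP A12 /rel_onP T2A /fsubsetP BA; split => oB x y.
  by move=> xy; apply: oB; rewrite in_fsetU xy.
by move=> /fsetUP[/oB //|/T2A[xA2 _] /BA /A12]; rewrite xA2.
Qed.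

(* The two families of terms with [B] inside a factor are all that survives in
   the recursion for a product, and they reproduce Y, which is a derivation. *)
Lemma sum_Dynkin_factor A1 A2 T1 T2 phi : [disjoint A1 & A2] -> A2 != fset0 ->
  rel_on A1 T1 -> rel_on A2 T2 ->
  \sum_(B <- fpowerset (A1 `|` A2) |
      ((B != A1 `|` A2) && `[< is_open (T1 `|` T2) B >]) && (B `<=` A1))
    Dynkin B (restr (T1 `|` T2) B)
      (fun S => phi (restr (T1 `|` T2) ((A1 `|` A2) `\` B) `|` S))
  = #|` A1|%:R * phi (T1 `|` T2).
Proof.
move=> A12 A2n T1A T2A.
have nA : ~~ (A1 `|` A2 `<=` A1).
  rewrite fsubUset negb_and; apply/orP; right.
  have /fset0Pn[x xA2] := A2n; apply/fsubsetPn; exists x => //.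
  by rewrite fdisjoint_sym in A12; move/fdisjointP: A12; apply.
(* [A1] itself is a proper subset of the union, so no term is missing: this is the complete sum of
   Id * D at [T1], for the form obtained by multiplying with [T2]. *)
rewrite -(sum_Dynkin (fun S => phi (S `|` T2)) T1A).
apply: eq_fbig_cond => [B|B _].
  rewrite !inE /= !fpowersetE; have [BA|] := boolP (B `<=` A1); last first.
    by rewrite !andbF.
  rewrite (fsubset_trans BA) ?fsubsetUl //= !andbT.
  rewrite (_ : B != _) /=; last by apply: contraNneq nA => <-.
  by apply: asbool_equiv_eq; apply: is_openU A12 T2A BA.
case/andP=> _ BA; rewrite (restr_disjU T1 A12 T2A BA).
apply: Dynkin_ext => [|S _]; first exact: restr_on.
have -> : restr (T1 `|` T2) ((A1 `|` A2) `\` B) = restr T1 (A1 `\` B) `|` T2.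
  rewrite restrU; congr (_ `|` _).
    rewrite -(restrI _ T1A) -[RHS](restrI _ T1A); congr restr.
    by apply/fsetP => x; rewrite !inE; case: (x \in A1); rewrite ?andbF ?andbT.
  rewrite -(restrI _ T2A) restr_id //; have <- // : A2 = A2 `&` ((A1 `|` A2) `\` B).
  apply/fsetP => x; rewrite !inE; have [xA2|//] := boolP (x \in A2).
  rewrite orbT andbT; apply/esym; apply/negP => /(fsubsetP BA).
  by move/(fdisjointP A12); rewrite xA2.
by rewrite fsetUAC.
Qed.

(** Strong induction on the cardinality: an open set meeting both factors gives a smaller instance,
    hence zero. The sets inside one factor contribute [#|A1|] and [#|A2|] times [phi], which cancel
    the leading term. *)
Lemma Dynkin_disjU A1 A2 T1 T2 phi : [disjoint A1 & A2] ->
  A1 != fset0 -> A2 != fset0 -> rel_on A1 T1 -> rel_on A2 T2 ->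
  Dynkin (A1 `|` A2) (T1 `|` T2) phi = 0.
Proof.
have [n] := ubnP #|` A1 `|` A2|; elim: n => // n IH in A1 A2 T1 T2 phi *.
move=> An A12 A1n A2n T1A T2A; rewrite DynkinE.
pose F B := Dynkin B (restr (T1 `|` T2) B)
  (fun S => phi (restr (T1 `|` T2) ((A1 `|` A2) `\` B) `|` S)).
set P := fun B => (B != A1 `|` A2) && `[< is_open (T1 `|` T2) B >].
have -> : \sum_(B <- fpowerset (A1 `|` A2) | P B) F B =
    \sum_(B <- fpowerset (A1 `|` A2) | P B && (B `<=` A1)) F B +
    \sum_(B <- fpowerset (A1 `|` A2) | P B && (B `<=` A2)) F B.
  rewrite [X in _ = X + _]big_mkcondr [X in _ = _ + X]big_mkcondr -big_split.
  apply: eq_fbigr => B BA /= /andP[nBA _].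
  have [B1|B1] := boolP (B `<=` A1); have [B2|B2] := boolP (B `<=` A2).
  (* The empty set is the only one counted in both families, and D is zero there. *)
  - suff -> : B = fset0 by rewrite /F Dynkin0 addr0.
    by apply/eqP; rewrite -fsubset0 -(eqP A12) fsubsetI B1.
  - by rewrite addr0.
  - by rewrite add0r.
  rewrite addr0 /F.
  have EB : B = (B `&` A1) `|` (B `&` A2).
    by rewrite -fsetIUr; apply/esym/fsetIidPl; rewrite -fpowersetE.
  have ET : restr (T1 `|` T2) B = restr T1 (B `&` A1) `|` restr T2 (B `&` A2).
    by rewrite restrU ![B `&` _]fsetIC !restrI.
  rewrite ET [X in Dynkin X _ _]EB; apply: IH; rewrite ?restr_on //.
  - by rewrite -EB (leq_trans (proper_card BA nBA)).
  - by apply: fdisjointWl (fsubsetIr _ _) _; apply: fdisjointWr (fsubsetIr _ _) _.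
  - apply: contraNneq B2 => B10; rewrite EB B10 fset0U fsubsetIr //.
  - apply: contraNneq B1 => B20; rewrite EB B20 fsetU0 fsubsetIr //.
have -> : \sum_(B <- fpowerset (A1 `|` A2) | P B && (B `<=` A1)) F B =
   #|` A1|%:R * phi (T1 `|` T2).
  exact: sum_Dynkin_factor.
have -> : \sum_(B <- fpowerset (A1 `|` A2) | P B && (B `<=` A2)) F B =
   #|` A2|%:R * phi (T1 `|` T2).
  rewrite /F /P fsetUC [T1 `|` T2]fsetUC; apply: sum_Dynkin_factor => //.
  by rewrite fdisjoint_sym.
rewrite -mulrDl -natrD cardfsU (eqP A12) cardfs0 subn0.
by rewrite subrr.
Qed.

End Dynkin.

(** * Transport along injections *)

Lemma fimageP s A y : reflect (exists2 x, x \in A & y = s x) (y \in fimage s A).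
Proof. exact: imfsetP. Qed.

Lemma transportP s T y z :
  reflect (exists a b, [/\ (a, b) \in T, y = s a & z = s b])
          ((y, z) \in transport s T).
Proof.
apply: (iffP (imfsetP _ _ _ _)) => [[[a b] abT [-> ->]]|[a [b [abT -> ->]]]].
  by exists a, b.
by exists (a, b).
Qed.

Lemma transport_on s A T : rel_on A T -> rel_on (fimage s A) (transport s T).
Proof.
move/rel_onP=> TA; apply/rel_onP => y z /transportP[a [b [/TA[aA bA] -> ->]]].
by split; apply: in_imfset.
Qed.

Lemma transportU s T S : transport s (T `|` S) = transport s T `|` transport s S.
Proof. exact: imfsetU. Qed.

Lemma transport_id T : transport id T = T.
Proof.
apply/fsetP => -[x y]; apply/transportP/idP => [[a [b [abT -> ->]]] //|xyT].
by exists x, y.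
Qed.

Lemma transport_comp s t T : transport (t \o s) T = transport t (transport s T).
Proof.
apply/fsetP => -[x y]; apply/transportP/transportP.
  move=> [a [b [abT -> ->]]]; exists (s a), (s b); split=> //.
  by apply/transportP; exists a, b.
by move=> [c [e [/transportP[a [b [abT -> ->]]] -> ->]]]; exists a, b.
Qed.

Lemma fimage_comp s t A : fimage (t \o s) A = fimage t (fimage s A).
Proof. by rewrite /fimage -imfset_comp. Qed.

Lemma fimage_id A : fimage id A = A.
Proof. by apply/fsetP => x; apply/fimageP/idP => [[y yA ->]|xA] //; exists x. Qed.

Lemma eq_in_fimage s t A : {in A, s =1 t} -> fimage s A = fimage t A.
Proof.
by move=> st; apply/fsetP => x; apply/fimageP/fimageP => -[y yA ->]; exists y;
  rewrite ?st.
Qed.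

Lemma eq_in_transport s t A T : rel_on A T -> {in A, s =1 t} ->
  transport s T = transport t T.
Proof.
move=> /rel_onP TA st; apply/fsetP => -[x y].
by apply/transportP/transportP => -[a [b [abT -> ->]]]; exists a, b;
  have [aA bA] := TA _ _ abT; rewrite !st.
Qed.

Lemma fimageS s A B : B `<=` A -> fimage s B `<=` fimage s A.
Proof.
move=> /fsubsetP BA; apply/fsubsetP => y /fimageP[x xB ->].
by apply/fimageP; exists x; rewrite ?BA.
Qed.

Lemma fimage_eq0 s A : (fimage s A == fset0) = (A == fset0).
Proof.
apply/idP/idP => [|/eqP->]; last by rewrite /fimage imfset0.
apply: contraLR => /fset0Pn[x xA]; apply/fset0Pn; exists (s x).
exact: in_imfset.
Qed.

Definition fpreimage s A (C : {fset nat}) := [fset x in A | s x \in C].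

Lemma fpreimage_sub s A C : fpreimage s A C `<=` A.
Proof. by apply/fsubsetP => x; rewrite !inE => /andP[]. Qed.

Lemma fpreimageK s A C : C `<=` fimage s A -> fimage s (fpreimage s A C) = C.
Proof.
move=> /fsubsetP CA; apply/fsetP => y; apply/fimageP/idP.
  by move=> [x]; rewrite !inE => /andP[_ ? ->].
move=> yC; have /fimageP[x xA E] := CA _ yC; exists x => //.
by rewrite !inE xA /= -E.
Qed.

Section InjectiveTransport.
Variables (s : nat -> nat) (A : {fset nat}).
Hypothesis injs : {in A &, injective s}.

Lemma mem_fimage B x : B `<=` A -> x \in A -> (s x \in fimage s B) = (x \in B).
Proof.
move=> /fsubsetP BA xA; apply/fimageP/idP => [[y yB E]|xB]; last by exists x.
by rewrite (injs xA (BA _ yB) E).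
Qed.

Lemma mem_transport T x y : rel_on A T -> x \in A -> y \in A ->
  ((s x, s y) \in transport s T) = ((x, y) \in T).
Proof.
move=> /rel_onP TA xA yA; apply/transportP/idP => [[a [b [abT ax yb]]]|xyT].
  have [aA bA] := TA _ _ abT.
  by rewrite (injs xA aA ax) (injs yA bA yb).
by exists x, y.
Qed.

Lemma transport_inj T S : rel_on A T -> rel_on A S ->
  transport s T = transport s S -> T = S.
Proof.
move=> TA SA E; apply/fsetP => -[x y]; apply/idP/idP => xy.
  have [xA yA] := rel_onP _ _ TA _ _ xy.
  by rewrite -mem_transport // -E mem_transport.
have [xA yA] := rel_onP _ _ SA _ _ xy.
by rewrite -mem_transport // E mem_transport.
Qed.

Lemma fimage_inj : {in fpowerset A &, injective (fimage s)}.
Proof.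
move=> B C; rewrite !fpowersetE => BA CA E; apply/fsetP => x.
apply/idP/idP => xX.
  by have xA := fsubsetP BA _ xX; rewrite -mem_fimage // -E in_imfset.
by have xA := fsubsetP CA _ xX; rewrite -mem_fimage // E in_imfset.
Qed.

Lemma fpowerset_fimage :
  fpowerset (fimage s A) = [fset fimage s B | B in fpowerset A].
Proof.
apply/fsetP => C; rewrite fpowersetE; apply/idP/imfsetP => /=.
  move=> CA; exists (fpreimage s A C); last by rewrite fpreimageK.
  by rewrite fpowersetE fpreimage_sub.
by move=> [B]; rewrite fpowersetE => BA ->; apply: fimageS.
Qed.

Lemma card_fimage : #|` fimage s A| = #|` A|.
Proof. exact: card_in_imfset. Qed.

Lemma fimageD B : B `<=` A -> fimage s (A `\` B) = fimage s A `\` fimage s B.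
Proof.
move=> BA; apply/fsetP => y; rewrite in_fsetD; apply/fimageP/andP.
  move=> [x]; rewrite in_fsetD => /andP[xB xA] ->.
  by rewrite mem_fimage // in_imfset.
move=> [yB /fimageP[x xA E]]; exists x => //.
by rewrite in_fsetD xA andbT -mem_fimage // -E.
Qed.

Lemma transport_restr T B : rel_on A T -> B `<=` A ->
  transport s (restr T B) = restr (transport s T) (fimage s B).
Proof.
move=> TA BA; apply/fsetP => -[y z]; rewrite in_restr /=.
apply/transportP/and3P => [[a [b []]]|[]].
  rewrite in_restr => /and3P[abT aB bB] -> ->; split; last 2 first.
  - exact: in_imfset.
  - exact: in_imfset.
  by apply/transportP; exists a, b.
move=> /transportP[a [b [abT -> ->]]]; have [aA bA] := rel_onP _ _ TA _ _ abT.
by rewrite !mem_fimage // => aB bB; exists a, b; rewrite in_restr abT /= aB.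
Qed.

Lemma is_open_transport T B : rel_on A T -> B `<=` A ->
  is_open (transport s T) (fimage s B) <-> is_open T B.
Proof.
move=> TA BA; split => oB x y.
  move=> xy xB; have [xA yA] := rel_onP _ _ TA _ _ xy.
  rewrite -mem_fimage //; apply: (oB (s x)); rewrite ?mem_transport //.
  exact: in_imfset.
move=> /transportP[a [b [ab -> ->]]]; have [aA bA] := rel_onP _ _ TA _ _ ab.
by rewrite !mem_fimage //; apply: oB.
Qed.

Lemma topology_transport T :
  is_topology A T -> is_topology (fimage s A) (transport s T).
Proof.
move=> tT; have TA := topology_rel_on tT; have [_ rT cT] := tT; split.
- by move=> [x y] /(rel_onP _ _ (transport_on s TA))[/= -> ->].
- by move=> x /fimageP[a aA ->]; rewrite mem_transport ?rT.
move=> x y z /transportP[a [b [ab -> ->]]].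
have [aA bA] := rel_onP _ _ TA _ _ ab.
move=> /transportP[c [e [ce bc ->]]]; have [cA eA] := rel_onP _ _ TA _ _ ce.
by rewrite mem_transport //; apply: cT ab _; rewrite (injs bA cA bc).
Qed.

End InjectiveTransport.

Lemma subset_inj s A B : B `<=` A ->
  {in A &, injective s} -> {in B &, injective s}.
Proof. by move=> /fsubsetP BA injs x y /BA xA /BA yA; apply: injs. Qed.

Lemma exists_relabeling A B : #|` A| = #|` B| ->
  exists2 s, {in A &, injective s} & fimage s A = B.
Proof.
move=> AB; pose s x := nth 0%N (enum_fset B) (index x (enum_fset A)).
have idx x : x \in A -> (index x (enum_fset A) < #|` B|)%N.
  by move=> xA; rewrite -AB index_mem.
have injs : {in A &, injective s}.
  move=> x y xA yA /eqP; rewrite nth_uniq ?fset_uniq ?idx // => /eqP E.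
  by rewrite -(nth_index 0%N xA) E nth_index.
exists s => //; apply/eqP; rewrite eqEfcard card_fimage // AB leqnn andbT.
by apply/fsubsetP => y /fimageP[x xA ->]; apply: mem_nth; apply: idx.
Qed.

Lemma exists_inverse s A : {in A &, injective s} ->
  exists2 t, {in A, cancel s t} & {in fimage s A, cancel t s}.
Proof.
move=> injs; pose t y := nth 0%N (enum_fset A) (index y (map s (enum_fset A))).
have st : {in A, cancel s t}.
  move=> x xA; apply: injs => //.
    apply: mem_nth; rewrite -(size_map s) index_mem; exact: map_f.
  rewrite /t -(nth_map _ (s 0%N)); last first.
    by rewrite -(size_map s) index_mem; exact: map_f.
  by rewrite nth_index //; exact: map_f.
by exists t => // y /fimageP[x xA ->]; rewrite st.
Qed.

Section DynkinTransport.
Variable K : fieldType.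

(** D is natural because the open subsets of the image are exactly the images of the open
    subsets. *)
Lemma Dynkin_transport s A T (phi : {fset (nat * nat)} -> K) :
  {in A &, injective s} -> rel_on A T ->
  Dynkin (fimage s A) (transport s T) phi = Dynkin A T (phi \o transport s).
Proof.
have [n] := ubnP #|` A|; elim: n => // n IH in A T phi * => An injs TA.
rewrite !DynkinE card_fimage //; congr (_ - _).
rewrite fpowerset_fimage // big_mkcond big_imfset /=; last exact: fimage_inj.
rewrite -big_mkcond /=; apply: eq_fbig_cond => [B|B].
  rewrite !inE; have [|//] := boolP (B \in fpowerset A) => BA /=.
  have AA : A \in fpowerset A by rewrite fpowersetE.
  rewrite (inj_in_eq (fimage_inj injs)) //; congr (_ && _); rewrite fpowersetE in BA.
  by apply: asbool_equiv_eq; apply: is_open_transport BA.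
move=> BA /andP[nBA _]; have ltBA : (#|` B| < #|` A|)%N.
  by apply: proper_card BA _; apply: contraNneq nBA => ->.
rewrite fpowersetE in BA.
rewrite -(transport_restr injs TA BA) IH ?restr_on //; last 2 first.
- exact: leq_trans ltBA _.
- exact: subset_inj injs.
congr Dynkin; apply/funext => S /=; rewrite transportU; congr (phi (_ `|` _)).
by rewrite -(fimageD injs BA) (transport_restr injs TA) // fsubsetDl.
Qed.

(** Here [a] maps basis vectors to basis vectors and [G] is a linear form on the target: if the
    pushforward of [h] is zero, so is its pairing with [G]. *)
Lemma sum_fibers0 (I J : choiceType) (X : {fset I}) (P : pred I) (h : I -> K)
    (a : I -> J) (G : J -> K) :
  (forall c, \sum_(i <- X | P i && (a i == c)) h i = 0) ->
  \sum_(i <- X | P i) h i * G (a i) = 0.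
Proof.
move=> h0; rewrite big_mkcond (partition_big_imfset _ a) /= big1 // => c _.
rewrite (eq_bigr (fun i => (if P i then h i else 0) * G c)); last first.
  by move=> i /eqP->; case: ifP; rewrite ?mul0r.
by rewrite -big_distrl -big_mkcondl /= h0 mul0r.
Qed.

(* [h] is an element of Top[A], as a family of coordinates. *)
Lemma sum_Dynkin_primitive A (X : {fset {fset (nat * nat)}})
    (h : {fset (nat * nat)} -> K) phi :
  (forall B S1 S2, B `<=` A -> B != fset0 -> B != A ->
     \sum_(T <- X | `[< is_open T B >] && (restr T (A `\` B) == S1)
                    && (restr T B == S2)) h T = 0) ->
  \sum_(T <- X) h T * Dynkin A T phi = #|` A|%:R * \sum_(T <- X) h T * phi T.
Proof.
move=> prim; under eq_bigr do rewrite DynkinE mulrBr.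
rewrite sumrB big_distrr /=.
under [X in X - _]eq_bigr do rewrite mulrCA.
apply/eqP; rewrite subr_eq addrC -subr_eq subrr eq_sym; apply/eqP.
under eq_bigr do rewrite big_distrr big_mkcond /=.
rewrite exchange_big big1_fset //= => B BA _.
have [->|nBA] := eqVneq B A; first by rewrite big1.
have [->|nB0] := eqVneq B fset0.
  by rewrite big1 // => T _; rewrite Dynkin0 mulr0 if_same.
rewrite -big_mkcond /=.
(* For fixed [B] the term depends on [T] only through its two restrictions, and [prim] says that
   this component of the coproduct of [h] vanishes. *)
apply: (@sum_fibers0 _ _ X (fun T => `[< is_open T B >]) h
  (fun T => (restr T (A `\` B), restr T B))
  (fun c => Dynkin B c.2 (fun S => phi (c.1 `|` S)))) => -[S1 S2].
rewrite -[RHS](prim B S1 S2) ?fpowersetE -?fpowersetE //.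
by apply: eq_bigl => T; rewrite xpair_eqE andbA.
Qed.

End DynkinTransport.

(** * Irreducible topologies and the species Q *)

(* [T] is the ordinal sum of its restrictions to [B] and to [A `\` B]. *)
Definition splits A T B : Prop :=
  [/\ B `<=` A, B != fset0, B != A &
      forall x y, x \in B -> y \in A `\` B -> (x, y) \in T /\ (y, x) \notin T].

Definition irreducible A T : Prop :=
  [/\ is_topology A T, A != fset0 & forall B, ~ splits A T B].

Definition topologies_on A : {fset {fset (nat * nat)}} :=
  [fset T in fpowerset (A `*` A) | `[< is_topology A T >]].

Definition irreducibles_on A : {fset {fset (nat * nat)}} :=
  [fset T in fpowerset (A `*` A) | `[< irreducible A T >]].

Lemma topologies_onP A T : reflect (is_topology A T) (T \in topologies_on A).
Proof.
rewrite !inE /= fpowersetE; apply: (iffP andP) => [[_ /asboolP]//|tT].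
by rewrite topology_rel_on //; split=> //; apply/asboolP.
Qed.

Lemma irreducible_topology A T : irreducible A T -> is_topology A T.
Proof. by case. Qed.

Lemma irreducibles_onP A T : reflect (irreducible A T) (T \in irreducibles_on A).
Proof.
rewrite !inE /= fpowersetE; apply: (iffP andP) => [[_ /asboolP]//|tT].
rewrite topology_rel_on; last exact: irreducible_topology.
by split=> //; apply/asboolP.
Qed.

Lemma irreducible_transport s A T : {in A &, injective s} ->
  irreducible A T -> irreducible (fimage s A) (transport s T).
Proof.
move=> injs [tT An nT]; split; first exact: topology_transport.
  by rewrite fimage_eq0.
move=> C [CA C0 nCA spC]; apply: (nT (fpreimage s A C)).
have TA := topology_rel_on tT; have EC := fpreimageK CA.
have BA := fpreimage_sub s A C; split=> //.
- by apply: contraNneq C0 => B0; rewrite -EC B0 fimage_eq0.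
- by apply: contraNneq nCA => BAE; rewrite -EC BAE.
move=> x y; rewrite in_fsetD !inE /= => /andP[xA xC] /andP[+ yA].
rewrite yA /= => yC; have := spC (s x) (s y) xC.
rewrite in_fsetD yC in_imfset // => /(_ isT).
by rewrite !(mem_transport injs).
Qed.

(** Dimensions must depend on the cardinality alone, so the count is made on a reference set;
    [card_irreducibles] carries it to any set. *)
Definition num_irreducible n :=
  #|` irreducibles_on [fset i in iota 0 n]|.

Lemma leq_card_irreducibles A B : #|` A| = #|` B| ->
  (#|` irreducibles_on A| <= #|` irreducibles_on B|)%N.
Proof.
move=> AB; have [s injs <-] := exists_relabeling AB.
have <- : #|` [fset transport s T | T in irreducibles_on A]|
          = #|` irreducibles_on A|.
  apply: card_in_imfset => T S /=.
  move=> /irreducibles_onP/irreducible_topology/topology_rel_on TA.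
  move=> /irreducibles_onP/irreducible_topology/topology_rel_on SA.
  exact: transport_inj TA SA.
apply/fsubset_leq_card/fsubsetP => S /imfsetP[T /= /irreducibles_onP TA ->].
by apply/irreducibles_onP/irreducible_transport.
Qed.

Lemma card_irreducibles A : #|` irreducibles_on A| = num_irreducible #|` A|.
Proof.
have E : #|` A| = #|` [fset i in iota 0 #|` A|]|.
  by rewrite card_imfset //= undup_id ?iota_uniq // size_iota.
by apply/eqP; rewrite eqn_leq !leq_card_irreducibles.
Qed.

(** The index follows the enumeration of a finite set, which relabelings do not respect; this is why
    [irr_act] is a permutation matrix rather than the identity. *)
Definition topology_of l : {fset (nat * nat)} :=
  nth fset0 (enum_fset (irreducibles_on l.1)) l.2.

Definition letter_of A T : letter :=
  (A, index T (enum_fset (irreducibles_on A))).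

Lemma topology_of_irreducible l : (l.2 < num_irreducible #|` l.1|)%N ->
  irreducible l.1 (topology_of l).
Proof.
by rewrite -card_irreducibles => ?; apply/irreducibles_onP/mem_nth.
Qed.

Lemma topology_of_on l : rel_on l.1 (topology_of l).
Proof.
have [/topology_of_irreducible/irreducible_topology/topology_rel_on //|] :=
  ltnP l.2 (num_irreducible #|` l.1|).
by rewrite -card_irreducibles => ?; rewrite /topology_of nth_default ?fsub0set.
Qed.

Lemma letter_ofK A T : irreducible A T -> topology_of (letter_of A T) = T.
Proof. by move=> /irreducibles_onP irr; rewrite /topology_of nth_index. Qed.

Lemma letter_of_lt A T : irreducible A T ->
  ((letter_of A T).2 < num_irreducible #|` A|)%N.
Proof. by move=> /irreducibles_onP; rewrite -card_irreducibles index_mem. Qed.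

Lemma topology_of_inj l l' : l.1 = l'.1 ->
  (l.2 < num_irreducible #|` l.1|)%N -> (l'.2 < num_irreducible #|` l'.1|)%N ->
  topology_of l = topology_of l' -> l = l'.
Proof.
case: l l' => [A i] [_ j] /= <-; rewrite -card_irreducibles => iA jA.
by rewrite /topology_of /= => /eqP; rewrite nth_uniq ?fset_uniq // => /eqP->.
Qed.

Lemma irreducibles_on0 : irreducibles_on fset0 = fset0.
Proof.
by apply/fsetP => T; rewrite in_fset0; apply/irreducibles_onP => -[_ /eqP].
Qed.

Lemma num_irreducible0 : num_irreducible 0 = 0%N.
Proof. by rewrite -(cardfs0 nat) -card_irreducibles irreducibles_on0 cardfs0. Qed.

Section Species.
Variable K : fieldType.

Definition irr_act A s i j : K :=
  (transport s (topology_of (A, i)) == topology_of (fimage s A, j))%:R.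

Lemma irr_act_species : is_species num_irreducible irr_act.
Proof.
split=> [|A i j iA jA|A s t injs injt i k iA kA|A s s' ss' i j].
- exact: num_irreducible0.
- rewrite /irr_act transport_id fimage_id /topology_of /=.
  by rewrite nth_uniq ?fset_uniq ?card_irreducibles.
- have irrA := topology_of_irreducible (l := (A, i)) iA.
  have irrsA := irreducible_transport injs irrA.
  (* Row [i] of the matrix of [s] has a single nonzero entry, at the index of the transported
     topology, so the matrix product collapses to one term. *)
  pose j0 := Ordinal (letter_of_lt irrsA).
  have Ej0 : topology_of (fimage s A, val j0) = transport s (topology_of (A, i)).
    exact: letter_ofK irrsA.
  rewrite (bigD1 j0) // big1 => [|j nj].
    by rewrite [RHS]addr0 /irr_act Ej0 eqxx mul1r fimage_comp transport_comp.
  rewrite /irr_act.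
  have [E|_] := eqVneq (transport s _) (topology_of (fimage s A, val j)).
    case/negP: nj; apply/eqP/val_inj => /=.
    have [//] : (fimage s A, val j) = (fimage s A, val j0).
    by apply: topology_of_inj => //=; rewrite ?letter_of_lt // Ej0.
  by rewrite /= mul0r.
rewrite /irr_act (eq_in_fimage ss') (eq_in_transport _ ss') //.
exact: topology_of_on.
Qed.

End Species.

(** * Words and the coefficients of the morphism *)

Notation is_irr_word := (is_word num_irreducible).

Definition valid_letter l := (l.1 != fset0) && (l.2 < num_irreducible #|` l.1|)%N.

Definition support w : {fset nat} := \bigcup_(l <- w) l.1.

Lemma mem_support w x : reflect (exists2 l, l \in w & x \in l.1) (x \in support w).
Proof.
apply: (iffP (bigfcupP _ _ _ _)) => [[l /andP[lw _] xl]|[l lw xl]]; exists l => //.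
by rewrite lw.
Qed.

Lemma is_irr_wordP A w : is_irr_word A w <->
  [/\ all valid_letter w, pairwise (fun l l' => [disjoint l.1 & l'.1]%fset) w &
      support w = A].
Proof.
split=> [[vw pw sw]|[/allP vw pw sw]]; split=> //.
  by apply/allP => l /vw[l0 lN]; rewrite /valid_letter l0.
by move=> l /vw /andP.
Qed.

Lemma support_cons l w : support (l :: w) = l.1 `|` support w.
Proof. exact: big_cons. Qed.

Lemma disjoint_supportP A w :
  reflect (forall l, l \in w -> [disjoint A & l.1]) [disjoint A & support w]%fset.
Proof.
apply: (iffP idP) => [/fdisjointP AS l lw|Aw]; apply/fdisjointP => x xA.
  by apply: contraNN (AS _ xA) => xl; apply/mem_support; exists l.
by apply/mem_support => -[l /Aw /fdisjointP /(_ _ xA)/negPf->].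
Qed.

Lemma is_irr_word_cons A l w : is_irr_word A (l :: w) <->
  [/\ valid_letter l, l.1 `<=` A & is_irr_word (A `\` l.1) w].
Proof.
rewrite is_irr_wordP /= support_cons; split.
  move=> [/andP[vl vw] /andP[/allP lw pw] <-]; split; rewrite ?fsubsetUl //.
  apply/is_irr_wordP; split=> //; rewrite fsetDUl fsetDv fset0U.
  apply/esym/fsetDidPl.
  by rewrite fdisjoint_sym; apply/disjoint_supportP.
move=> [vl lA /is_irr_wordP[vw pw sw]]; split; first by rewrite vl.
  rewrite pw andbT; apply/allP => l' l'w.
  move/disjoint_supportP: l'w; apply; rewrite sw.
  by apply/fdisjointP => x xl; rewrite in_fsetD xl.
by rewrite sw fsetUDl fsetDv fsetD0; apply/fsetUidPr.
Qed.

Lemma is_irr_word0 A : is_irr_word A [::] <-> A = fset0.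
Proof.
rewrite is_irr_wordP /support big_nil.
by split=> [[_ _ <-]|->].
Qed.

Lemma is_irr_word_sub A w l : is_irr_word A w -> l \in w -> l.1 `<=` A.
Proof.
move=> [_ _ <-] lw; apply/fsubsetP => x xl; apply/mem_support.
by exists l.
Qed.

Lemma is_irr_word_valid A w l : is_irr_word A w -> l \in w -> valid_letter l.
Proof. by move/is_irr_wordP => -[/allP vw _ _] /vw. Qed.

Lemma is_irr_word_cat A B w1 w2 : [disjoint A & B] ->
  is_irr_word A w1 -> is_irr_word B w2 -> is_irr_word (A `|` B) (w1 ++ w2).
Proof.
move=> AB wA wB; have [v1 p1 s1] := (is_irr_wordP _ _).1 wA.
have [v2 p2 s2] := (is_irr_wordP _ _).1 wB.
apply/is_irr_wordP; rewrite all_cat v1 pairwise_cat p1 p2 /support big_cat /=.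
split=> //; last by rewrite -s1 -s2.
rewrite andbT; apply/allrelP => l l' /(is_irr_word_sub wA) lA.
move=> /(is_irr_word_sub wB) lB.
by apply: fdisjointWl lA _; apply: fdisjointWr lB _.
Qed.

Lemma is_irr_word_uniq A w : is_irr_word A w -> uniq w.
Proof.
move/is_irr_wordP => [vw pw _]; rewrite uniq_pairwise.
apply: sub_in_pairwise vw pw => l l' /andP[/fset0Pn[x xl] _] _ /fdisjointP dl.
by apply: contraNneq (dl _ xl) => <-.
Qed.

Lemma valid_irreducible l : valid_letter l -> irreducible l.1 (topology_of l).
Proof. by move=> /andP[_]; apply: topology_of_irreducible. Qed.

Lemma irreducible_valid A T : irreducible A T -> valid_letter (letter_of A T).
Proof. by move=> irr; rewrite /valid_letter letter_of_lt // andbT; case: irr. Qed.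

(** Imposed on all pairs with [l] before [l'], this makes the union of every suffix of a word open,
    which is when its component of the iterated coproduct is nonzero. *)
Definition descends T l l' : bool :=
  `[< forall x y, (x, y) \in T -> x \in l'.1 -> y \notin l.1 >].

Lemma descends_restr T A l l' : l.1 `<=` A -> l'.1 `<=` A ->
  descends (restr T A) l l' = descends T l l'.
Proof.
move=> /fsubsetP lA /fsubsetP l'A; apply: asbool_equiv_eq; split=> desc x y.
  move=> xyT xl'; apply/negP => yl.
  have xyr : (x, y) \in restr T A by rewrite in_restr xyT l'A ?lA.
  by have := desc _ _ xyr xl'; rewrite yl.
by rewrite in_restr => /and3P[+ _ _]; apply: desc.
Qed.

Section Coefficients.
Variable K : fieldType.

(** As [topology_of l] is irreducible for a valid letter, projecting onto Q and taking the
    coordinate on [l] amounts to reading off one coordinate of D. *)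
Definition letter_coef T l : K :=
  Dynkin l.1 (restr T l.1) (fun S => (S == topology_of l)%:R).

(* The component of f(T) on the word B_1 ... B_k: the iterated coproduct
   T|B_1 (x) ... (x) T|B_k, to whose factors the Dynkin operator followed by
   the projection onto the irreducible topologies is applied. *)
Definition top_coef A T w : K :=
  if `[< is_irr_word A w >] && pairwise (descends T) w
  then \prod_(l <- w) letter_coef T l else 0.

Lemma top_coef_supp A T w : top_coef A T w != 0 -> is_irr_word A w.
Proof. by rewrite /top_coef; case: asboolP => //=; rewrite eqxx. Qed.

Lemma top_coef_nil T : top_coef fset0 T [::] = 1.
Proof.
rewrite /top_coef big_nil; case: asboolP => //= nw.
by case: nw; apply/is_irr_word0.
Qed.

Lemma allrel_descends A B T w1 w2 : [disjoint A & B] -> rel_on (A `|` B) T ->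
  is_irr_word A w1 -> is_irr_word B w2 ->
  allrel (descends T) w1 w2 = `[< is_open T B >].
Proof.
move=> /fdisjointP AB /rel_onP TAB wA wB; apply/allrelP/asboolP.
  move=> desc x y xy xB; have [_ /fsetUP[yA|//]] := TAB _ _ xy.
  have [_ _ EA] := wA; have [_ _ EB] := wB.
  move: yA xB; rewrite -{1}EA -{1}EB => /mem_support[l lw yl].
  move=> /mem_support[l' lw' xl']; have /asboolP/(_ _ _ xy xl') := desc _ _ lw lw'.
  by rewrite yl.
move=> oB l l' lw lw'; apply/asboolP => x y xy xl'.
have yB : y \in B by apply: oB xy (fsubsetP (is_irr_word_sub wB lw') _ xl').
apply/negP => /(fsubsetP (is_irr_word_sub wA lw)) /AB.
by rewrite yB.
Qed.

Lemma pairwise_descends_restr A T w : is_irr_word A w ->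
  pairwise (descends (restr T A)) w = pairwise (descends T) w.
Proof.
move=> wA; apply: (@eq_in_pairwise _ (mem w)); last exact/allP.
by move=> l l' /(is_irr_word_sub wA) lA /(is_irr_word_sub wA); apply: descends_restr.
Qed.

Lemma letter_coef_restr T A l : l.1 `<=` A ->
  letter_coef (restr T A) l = letter_coef T l.
Proof. by move=> lA; rewrite /letter_coef restr_restr. Qed.

Lemma top_coefE A T w : is_irr_word A w ->
  top_coef A T w =
  (pairwise (descends T) w)%:R * \prod_(l <- w) letter_coef T l.
Proof.
move=> wA; rewrite /top_coef; case: asboolP => //= _.
by case: pairwise; rewrite ?mul1r ?mul0r.
Qed.

(** Pairs of letters across the cut decide whether [B] is open; every other pair, and every letter,
    sees only one of the two restrictions. *)
Lemma top_coef_cat A B T w1 w2 : [disjoint A & B] -> rel_on (A `|` B) T ->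
  is_irr_word A w1 -> is_irr_word B w2 ->
  top_coef (A `|` B) T (w1 ++ w2) =
  if `[< is_open T B >]
  then top_coef A (restr T A) w1 * top_coef B (restr T B) w2 else 0.
Proof.
move=> AB TAB wA wB; rewrite top_coefE; last exact: is_irr_word_cat.
rewrite pairwise_cat (allrel_descends AB TAB wA wB).
case: asboolP => _ /=; last by rewrite mul0r.
rewrite !top_coefE // !pairwise_descends_restr // big_cat /= -mulnb natrM.
rewrite -!mulrA; congr (_ * _); rewrite [RHS]mulrCA; congr (_ * _); congr (_ * _).
  rewrite [LHS]big_seq [RHS]big_seq; apply: eq_bigr => l lw.
  by rewrite letter_coef_restr // (is_irr_word_sub wA).
rewrite [LHS]big_seq [RHS]big_seq; apply: eq_bigr => l lw.
by rewrite letter_coef_restr // (is_irr_word_sub wB).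
Qed.

Definition map_letter s l := letter_of (fimage s l.1) (transport s (topology_of l)).

Lemma topology_of_map_letter s l : {in l.1 &, injective s} -> valid_letter l ->
  topology_of (map_letter s l) = transport s (topology_of l).
Proof.
by move=> injs vl; apply/letter_ofK/irreducible_transport/valid_irreducible.
Qed.

Lemma valid_map_letter s l : {in l.1 &, injective s} -> valid_letter l ->
  valid_letter (map_letter s l).
Proof.
by move=> injs vl; apply/irreducible_valid/irreducible_transport/valid_irreducible.
Qed.

Lemma map_letterK s t l : {in l.1, cancel s t} -> valid_letter l ->
  map_letter t (map_letter s l) = l.
Proof.
move=> st vl; have injs := can_in_inj st.
have El : fimage t (fimage s l.1) = l.1.
  by rewrite -fimage_comp -[RHS]fimage_id; apply: eq_in_fimage.
have vsl := valid_map_letter injs vl.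
have injt : {in (map_letter s l).1 &, injective t}.
  by move=> y z /fimageP[a al ->] /fimageP[b bl ->]; rewrite !st // => ->.
apply: topology_of_inj => //.
- by have /andP[_] := valid_map_letter injt vsl.
- by have /andP[_] := vl.
rewrite !topology_of_map_letter // -transport_comp -[RHS]transport_id.
by apply: eq_in_transport (topology_of_on l) _.
Qed.

Lemma is_irr_word_map s A w : {in A &, injective s} -> is_irr_word A w ->
  is_irr_word (fimage s A) (map (map_letter s) w).
Proof.
elim: w A => [|l w IH] A injs; rewrite /=.
  by move=> /is_irr_word0 ->; apply/is_irr_word0/imfset0.
move=> /is_irr_word_cons[vl lA wA]; apply/is_irr_word_cons; split.
- by apply: valid_map_letter vl; apply: subset_inj injs.
- exact: fimageS.
rewrite -(fimageD injs lA); apply: IH wA.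
by apply: subset_inj injs; apply: fsubsetDl.
Qed.

Lemma top_coef_map s A T w : {in A &, injective s} -> rel_on A T ->
  is_irr_word A w ->
  top_coef (fimage s A) (transport s T) (map (map_letter s) w) = top_coef A T w.
Proof.
move=> injs TA wA; rewrite !top_coefE //; last exact: is_irr_word_map.
congr (_%:R * _).
  rewrite pairwise_map; congr (nat_of_bool _).
  apply: (@eq_in_pairwise _ (mem w)); last exact/allP.
  move=> l l' /(is_irr_word_sub wA) lA /(is_irr_word_sub wA) l'A /=.
  apply: asbool_equiv_eq; split => desc x y.
    move=> xy xl'; have [xA yA] := rel_onP _ _ TA _ _ xy.
    rewrite -(mem_fimage injs lA yA).
    by apply: (desc (s x)); rewrite ?(mem_transport injs) ?(mem_fimage injs l'A).
  move=> /transportP[a [b [ab -> ->]]]; have [aA bA] := rel_onP _ _ TA _ _ ab.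
  by rewrite (mem_fimage injs l'A) ?(mem_fimage injs lA) //; apply: desc.
rewrite big_map big_seq [RHS]big_seq; apply: eq_bigr => l lw.
have lA := is_irr_word_sub wA lw; have injl := subset_inj lA injs.
have vl := is_irr_word_valid wA lw.
rewrite /letter_coef /= -(transport_restr injs TA lA).
rewrite Dynkin_transport ?restr_on //; apply: Dynkin_ext; first exact: restr_on.
move=> S Sl /=; rewrite topology_of_map_letter //; congr (nat_of_bool _)%:R.
by apply/eqP/eqP => [|-> //]; apply: transport_inj Sl (topology_of_on l).
Qed.

(** A product of entries of permutation matrices: the action sends words to words, letter by
    letter. *)
Lemma cot_actE s w w' : (forall l, l \in w -> {in l.1 &, injective s}) ->
  all valid_letter w -> all valid_letter w' ->
  cot_act (irr_act K) s w w' = (map (map_letter s) w == w')%:R.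
Proof.
rewrite /cot_act; elim: w w' => [|l w IH] [|l' w'] //= injs.
  by rewrite big_nil.
move=> /andP[vl vw] /andP[vl' vw'].
have {}IH := IH w' (fun l lw => injs _ (mem_behead (s := _ :: _) lw)) vw vw'.
rewrite eqSS eqseq_cons big_cons /=.
have [El'|nl'] := eqVneq l'.1 (fimage s l.1); last first.
  rewrite andbF (negPf (_ : map_letter s l != l')) //.
  by apply: contraNneq nl' => <-.
have -> : irr_act K l.1 s l.2 l'.2 = (map_letter s l == l')%:R.
  rewrite /irr_act -El' -!surjective_pairing; congr (nat_of_bool _)%:R.
  have injl := injs l (mem_head _ _).
  rewrite -topology_of_map_letter //; apply/eqP/eqP => [E|-> //].
  apply: topology_of_inj E => //; last by case/andP: vl'.
  by case/andP: (valid_map_letter injl vl).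
by rewrite -mulnb natrM -IH /=; case: ifP; rewrite ?mulr0.
Qed.

End Coefficients.

(** * The shuffle product *)

Lemma pairwise_index (T : eqType) (w : seq T) : uniq w ->
  pairwise (fun x y => index x w < index y w)%N w.
Proof.
case: w => // x0 w uw; apply/(pairwiseP x0) => i j iw jw ij.
by rewrite !index_uniq.
Qed.

(** Without repetitions a subword is a set of letters met at increasing positions, which is the form
    in which [is_shuffle_perm] constrains each factor. *)
Lemma subseq_index (T : eqType) (u w : seq T) : uniq w -> {subset u <= w} ->
  subseq u w = pairwise (fun x y => index x w < index y w)%N u.
Proof.
move=> uw sub; apply/idP/idP => [uw'|pu].
  exact: subseq_pairwise uw' (pairwise_index uw).
apply/subseq_uniqP => //.
apply: (@irr_sorted_eq _ (fun x y => index x w < index y w)%N).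
- by move=> x y z; apply: ltn_trans.
- by move=> x; rewrite ltnn.
- exact: pairwise_sorted.
- apply: pairwise_sorted; apply: subseq_pairwise (pairwise_index uw).
  exact: filter_subseq.
by move=> x; rewrite mem_filter; case: (boolP (x \in u)) => // /sub ->.
Qed.

Notation letter0 := ((fset0, 0%N) : letter).

Lemma size_shuffle_word u v (s : 'S_(size u + size v)) :
  size (@shuffle_word u v s) = (size u + size v)%N.
Proof. by rewrite size_map size_enum_ord. Qed.

Lemma nth_shuffle_word u v (s : 'S_(size u + size v)) (i : 'I_(size u + size v)) :
  nth letter0 (shuffle_word s) (s i) = nth letter0 (u ++ v) i.
Proof.
rewrite (nth_map (s i)) ?size_enum_ord ?ltn_ord //.
by rewrite nth_ord_enum permK.
Qed.

Lemma perm_shuffle_word u v (s : 'S_(size u + size v)) :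
  perm_eq (shuffle_word s) (u ++ v).
Proof.
have -> : u ++ v = [seq nth letter0 (u ++ v) (i : 'I_(size u + size v)) |
                     i <- enum 'I_(size u + size v)].
  apply: (@eq_from_nth _ letter0); first by rewrite size_map size_enum_ord size_cat.
  move=> i; rewrite size_cat => iuv.
  by rewrite (nth_map (Ordinal iuv)) ?size_enum_ord // nth_enum_ord.
rewrite /shuffle_word (map_comp (fun i : 'I__ => nth _ _ (val i)) (s^-1)%g).
apply: perm_map; apply: uniq_perm; rewrite ?enum_uniq //.
  by rewrite map_inj_uniq ?enum_uniq //; apply: perm_inj.
move=> i; rewrite mem_enum -[i](permK s) mem_map ?mem_enum //.
exact: perm_inj.
Qed.

Lemma is_shuffle_permE u v w (s : 'S_(size u + size v)) :
  (forall i : 'I_(size u + size v), index (nth letter0 (u ++ v) i) w = s i) ->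
  is_shuffle_perm s =
    pairwise (fun x y => index x w < index y w)%N u &&
    pairwise (fun x y => index x w < index y w)%N v.
Proof.
move=> sE.
apply/forallP/andP =>
  [incr | [/(pairwiseP letter0) pu /(pairwiseP letter0) pv] i].
  have {}incr (i j : 'I_(size u + size v)) :
      (((i < j) && (j < size u)) || ((size u <= i) && (i < j)))%N -> (s i < s j)%N.
    by move=> ij; have /forallP/(_ j)/implyP/(_ ij) := incr i.
  split; apply/(pairwiseP letter0) => i j; rewrite !inE => iu ju ij.
    have lt k : (k < size u -> k < size u + size v)%N by move=> ku; rewrite ltn_addr.
    have := incr (Ordinal (lt _ iu)) (Ordinal (lt _ ju)).
    by rewrite -!sE /= !nth_cat iu ju ij; apply.
  have lt k : (k < size v -> size u + k < size u + size v)%N by rewrite ltn_add2l.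
  have := incr (Ordinal (lt _ iu)) (Ordinal (lt _ ju)).
  rewrite -!sE /= !nth_cat !ltnNge !leq_addr /= !addKn -!ltnNge ltn_add2l ij orbT.
  by apply.
apply/forallP => j; apply/implyP; rewrite -!sE !nth_cat.
case/orP => /andP[].
  move=> ij ju; rewrite ju (ltn_trans ij ju); apply: pu => //.
  by rewrite !inE (ltn_trans ij ju).
move=> ui ij; have uj := leq_trans ui (ltnW ij).
rewrite !ltnNge ui uj /= -ltnNge; apply: pv.
- by rewrite inE ltn_subLR.
- by rewrite inE ltn_subLR.
by rewrite ltn_sub2rE.
Qed.

(** As the letters are distinct, the only permutation that can produce [w] sends each letter of
    [u ++ v] to its position in [w]; the coefficient is therefore 0 or 1. *)
Lemma shuffle_coefE u v w : uniq (u ++ v) ->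
  shuffle_coef u v w = [&& perm_eq (u ++ v) w, subseq u w & subseq v w] :> nat.
Proof.
move=> uuv; rewrite /shuffle_coef.
have [puv|npuv] /= := boolP (perm_eq (u ++ v) w); last first.
  apply: eq_card0 => s; rewrite inE; apply/negP => /andP[_ /eqP sw].
  by case/negP: npuv; rewrite -sw perm_sym perm_shuffle_word.
have uw : uniq w by rewrite -(perm_uniq puv).
have sw : size w = (size u + size v)%N by rewrite -(perm_size puv) size_cat.
have idx_lt (i : 'I_(size u + size v)) :
    (index (nth letter0 (u ++ v) i) w < size u + size v)%N.
  have : (index (nth letter0 (u ++ v) i) w < size w)%N.
    by rewrite index_mem -(perm_mem puv) mem_nth // size_cat.
  by rewrite sw.
have idx_inj : injective (fun i => Ordinal (idx_lt i)).
  move=> i j /(congr1 val) /= /(congr1 (nth letter0 w)).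
  rewrite !nth_index -?(perm_mem puv) ?mem_nth ?size_cat // => /eqP.
  by rewrite nth_uniq ?size_cat // => /eqP/val_inj.
pose s := perm idx_inj.
have sE (i : 'I_(size u + size v)) : index (nth letter0 (u ++ v) i) w = s i.
  by rewrite permE.
have wE : shuffle_word s = w.
  apply: (@eq_from_nth _ letter0); rewrite size_shuffle_word ?sw // => i iuv.
  have -> : i = s ((s^-1)%g (Ordinal iuv)) :> nat by rewrite permKV.
  rewrite nth_shuffle_word -sE nth_index // -(perm_mem puv) mem_nth //.
  by rewrite size_cat.
have -> : subseq u w && subseq v w = is_shuffle_perm s.
  rewrite (is_shuffle_permE sE) !subseq_index // => x xw; rewrite -(perm_mem puv).
    by rewrite mem_cat xw orbT.
  by rewrite mem_cat xw.
have s_only (s' : 'S_(size u + size v)) : shuffle_word s' = w -> s' = s.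
  move=> s'w; apply/permP => i; apply/val_inj => /=.
  rewrite -sE -(nth_shuffle_word s').
  by rewrite s'w index_uniq // sw.
case: (boolP (is_shuffle_perm s)) => ss.
  rewrite (_ : [set _ | _] = [set s]) ?cards1 //.
  apply/setP => s'; rewrite !inE; apply/andP/eqP => [[_ /eqP/s_only //]|->].
  by rewrite wE.
apply: eq_card0 => s'; rewrite inE; apply/negP => /andP[ss' /eqP/s_only E].
by move: ss; rewrite -E ss'.
Qed.

(** * Compatibility with products and relabelings *)

Lemma fsbig_only1 (V : nmodType) (I : choiceType) (P : set I) (x : I) (F : I -> V) :
  P x -> (forall y, P y -> y <> x -> F y = 0) -> \sum_(y \in P) F y = F x.
Proof.
move=> Px F0; rewrite -(fsbig_widen [set x]%classic) ?fsbig_set1 //.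
  by move=> y ->.
by move=> y [Py nyx]; apply: F0.
Qed.

(** Meant for [p] selecting the letters inside [A]: no pair of a disjoint union joins its two sides,
    so letters on different sides always satisfy [descends]. *)
Lemma pairwise_split (I : eqType) (r : rel I) (p : pred I) (w : seq I) :
  {in w &, forall x y, p x != p y -> r x y} ->
  pairwise r w = pairwise r (filter p w) && pairwise r (filter (predC p) w).
Proof.
elim: w => //= x w IH rp; rewrite IH; last first.
  by move=> y z yw zw; apply: rp; rewrite inE ?yw ?zw orbT.
have E : all (r x) w = all (r x) (filter p w) && all (r x) (filter (predC p) w).
  by rewrite -all_cat; apply/esym/perm_all; rewrite perm_filterC.
have rx (q : pred I) : (forall y, q y -> p x != p y) -> all (r x) (filter q w).
  move=> pq; apply/allP => y; rewrite mem_filter => /andP[/pq qy yw].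
  by apply: rp qy; rewrite inE ?eqxx ?yw ?orbT.
rewrite E; case px: (p x) => /=.
  rewrite (rx (predC p)) => [|y /= npy]; last by rewrite px eq_sym eqb_id.
  by rewrite andbT andbA.
rewrite (rx p) => [|y py]; last by rewrite px py.
by rewrite andbCA.
Qed.

Section Morphism.
Variable K : fieldType.

(** Letters are nonempty, so inclusion in [A] tells the letters of [w1] from those of [w2], and both
    words can be recovered from [w]. *)
Lemma shuffle_coef_words A B w1 w2 w : [disjoint A & B]%fset ->
  is_irr_word A w1 -> is_irr_word B w2 ->
  shuffle_coef w1 w2 w != 0%N ->
  [/\ all (fun l => (l.1 `<=` A) || (l.1 `<=` B)) w,
      w1 = [seq l <- w | l.1 `<=` A] & w2 = [seq l <- w | ~~ (l.1 `<=` A)]].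
Proof.
move=> AB wA wB; have w12 := is_irr_word_uniq (is_irr_word_cat AB wA wB).
rewrite shuffle_coefE //; case: and3P => // -[pw s1 s2] _.
have uw : uniq w by rewrite -(perm_uniq pw).
have w1A l : l \in w1 -> l.1 `<=` A by apply: is_irr_word_sub.
have w2A l : l \in w2 -> ~~ (l.1 `<=` A).
  move=> lw; apply/negP => lA.
  have /andP[/fset0Pn[x xl] _] := is_irr_word_valid wB lw.
  have /fdisjointP/(_ x) := AB; rewrite (fsubsetP lA) // => /(_ isT).
  by rewrite (fsubsetP (is_irr_word_sub wB lw)).
have memw l : l \in w -> (l \in w1) || (l \in w2).
  by rewrite -(perm_mem pw) mem_cat.
split.
- apply/allP => l /memw /orP[/w1A -> //|lw].
  by rewrite (is_irr_word_sub wB lw) orbT.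
- rewrite {1}(subseq_uniqP uw s1); apply: eq_in_filter => l lw.
  apply/idP/idP => [/w1A //|lA].
  by case/orP: (memw _ lw) => // /w2A; rewrite lA.
rewrite {1}(subseq_uniqP uw s2); apply: eq_in_filter => l lw.
apply/idP/idP => [/w2A //|lA].
by case/orP: (memw _ lw) => // /w1A; rewrite (negPf lA).
Qed.

(** A letter that meets both sides restricts the union to a product of two nonempty factors, which D
    kills. This is what excludes quasi-shuffle terms. *)
Lemma letter_coefU0 A B T1 T2 l : [disjoint A & B]%fset ->
  rel_on A T1 -> rel_on B T2 -> l.1 `<=` A `|` B ->
  ~~ (l.1 `<=` A) -> ~~ (l.1 `<=` B) -> letter_coef K (T1 `|` T2) l = 0.
Proof.
move=> AB T1A T2B lAB lA lB.
have El : l.1 = (l.1 `&` A) `|` (l.1 `&` B).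
  by rewrite -fsetIUr; apply/esym/fsetIidPl.
rewrite /letter_coef restrU -(restrI _ T1A) -(restrI _ T2B).
rewrite ![_ `&` l.1]fsetIC [X in Dynkin X _ _]El.
apply: Dynkin_disjU; rewrite ?restr_on //.
- by apply: fdisjointWl (fsubsetIr _ _) _; apply: fdisjointWr (fsubsetIr _ _) _.
- by apply: contraNneq lB => l0; rewrite El l0 fset0U fsubsetIr.
- by apply: contraNneq lA => l0; rewrite El l0 fsetU0 fsubsetIr.
Qed.

(** If some letter of [w] straddles [A] and [B], both sides are zero. Otherwise a single pair of
    words contributes, with coefficient 1: the letters inside [A] and the remaining ones. *)
Lemma top_coefU A B T1 T2 w : [disjoint A & B]%fset ->
  rel_on A T1 -> rel_on B T2 -> is_irr_word (A `|` B) w ->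
  top_coef K (A `|` B) (T1 `|` T2) w =
    \sum_(w1 \in words num_irreducible A) \sum_(w2 \in words num_irreducible B)
      top_coef K A T1 w1 * top_coef K B T2 w2 * (shuffle_coef w1 w2 w)%:R.
Proof.
move=> AB T1A T2B wAB.
have [spl|nspl] := boolP (all (fun l => (l.1 `<=` A) || (l.1 `<=` B)) w); last first.
  rewrite fsbig1 => [|w1 wA]; last first.
    apply: fsbig1 => w2 wB; have [->|/(shuffle_coef_words AB wA wB)[]] :=
      eqVneq (shuffle_coef w1 w2 w) 0%N; first by rewrite mulr0.
    by rewrite (negPf nspl).
  have /allPn[l lw] := nspl; rewrite negb_or => /andP[lA lB].
  rewrite top_coefE // (big_rem l) //= (letter_coefU0 AB) ?mul0r ?mulr0 //.
  exact: is_irr_word_sub wAB lw.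
set wA := [seq l <- w | l.1 `<=` A]; set wB := [seq l <- w | ~~ (l.1 `<=` A)].
have [vw pw sw] := (is_irr_wordP _ _).1 wAB.
have splB l : l \in w -> ~~ (l.1 `<=` A) -> l.1 `<=` B.
  by move=> /(allP spl)/orP[->|].
have wwA : is_irr_word A wA.
  apply/is_irr_wordP; rewrite pairwise_filter //; split=> //.
    by apply/allP => l; rewrite mem_filter => /andP[_ /(allP vw)].
  apply/fsetP => x; apply/mem_support/idP => [[l]|xA].
    by rewrite mem_filter => /andP[/fsubsetP lA _] /lA.
  have : x \in support w by rewrite sw in_fsetU xA.
  move=> /mem_support[l lw xl]; exists l => //; rewrite mem_filter lw andbT.
  apply: contraLR xA => /(splB _ lw) /fsubsetP/(_ _ xl) xB.
  by apply/negP => /(fdisjointP AB); rewrite xB.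
have wwB : is_irr_word B wB.
  apply/is_irr_wordP; rewrite pairwise_filter //; split=> //.
    by apply/allP => l; rewrite mem_filter => /andP[_ /(allP vw)].
  apply/fsetP => x; apply/mem_support/idP => [[l]|xB].
    by rewrite mem_filter => /andP[lA lw] /(fsubsetP (splB _ lw lA)).
  have : x \in support w by rewrite sw in_fsetU xB orbT.
  move=> /mem_support[l lw xl]; exists l => //; rewrite mem_filter lw andbT.
  by apply/negP => /fsubsetP/(_ _ xl)/(fdisjointP AB); rewrite xB.
have nw1 w1 w2 : is_irr_word A w1 -> is_irr_word B w2 -> ~ (w1 = wA /\ w2 = wB) ->
    top_coef K A T1 w1 * top_coef K B T2 w2 * (shuffle_coef w1 w2 w)%:R = 0.
  move=> ww1 ww2 n12; have [->|/(shuffle_coef_words AB ww1 ww2)[_ e1 e2]] :=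
    eqVneq (shuffle_coef w1 w2 w) 0%N; first by rewrite mulr0.
  by case: n12.
rewrite (@fsbig_only1 _ _ _ wA) //; last first.
  by move=> w1 ww1 n1; apply: fsbig1 => w2 ww2; apply: nw1 => // -[].
rewrite (@fsbig_only1 _ _ _ wB) //; last first.
  by move=> w2 ww2 n2; apply: nw1 => // -[].
have pAB : perm_eq (wA ++ wB) w by rewrite perm_filterC.
rewrite shuffle_coefE; last by rewrite (perm_uniq pAB) (is_irr_word_uniq wAB).
rewrite pAB !filter_subseq mulr1.
have ET1 : restr (T1 `|` T2) A = T1 by rewrite (restr_disjU _ AB T2B) // restr_id.
have ET2 : restr (T1 `|` T2) B = T2.
  by rewrite fdisjoint_sym in AB; rewrite fsetUC (restr_disjU _ AB T1A) ?restr_id.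
rewrite !top_coefE // (pairwise_split (p := fun l => l.1 `<=` A)); last first.
  move=> l l' lw l'w nll'; apply/asboolP => x y xy xl'; apply/negP => yl.
  case/fsetUP: xy => [/(rel_onP _ _ T1A)[xA yA]|/(rel_onP _ _ T2B)[xB yB]].
    case/negP: nll'.
    suff in_sub l1 z : l1 \in w -> z \in l1.1 -> z \in A -> l1.1 `<=` A.
      by rewrite (in_sub _ _ lw yl yA) (in_sub _ _ l'w xl' xA).
    move=> l1w zl zA; apply: contraLR zA => /(splB _ l1w)/fsubsetP/(_ _ zl) zB.
    by apply/negP => /(fdisjointP AB); rewrite zB.
  case/negP: nll'; suff out_sub l1 z : z \in l1.1 -> z \in B -> l1.1 `<=` A = false.
    by rewrite (out_sub _ _ yl yB) (out_sub _ _ xl' xB).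
  move=> zl zB; apply/negP => /fsubsetP/(_ _ zl)/(fdisjointP AB).
  by rewrite zB.
rewrite -[filter (predC _) w]/wB -/wA.
rewrite -(pairwise_descends_restr (T1 `|` T2) wwA) ET1.
rewrite -(pairwise_descends_restr (T1 `|` T2) wwB) ET2.
rewrite (bigID (fun l => l.1 `<=` A)) /=.
rewrite -[X in _ * (X * _) = _]big_filter -[X in _ * (_ * X) = _]big_filter.
rewrite -/wA -/wB.
have -> : \prod_(l <- wA) letter_coef K (T1 `|` T2) l =
    \prod_(l <- wA) letter_coef K T1 l.
  rewrite big_seq [RHS]big_seq; apply: eq_bigr => l /(is_irr_word_sub wwA) lA.
  by rewrite -{2}ET1 letter_coef_restr.
have -> : \prod_(l <- wB) letter_coef K (T1 `|` T2) l =
    \prod_(l <- wB) letter_coef K T2 l.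
  rewrite big_seq [RHS]big_seq; apply: eq_bigr => l /(is_irr_word_sub wwB) lB.
  by rewrite -{2}ET2 letter_coef_restr.
by rewrite -mulnb natrM mulrACA.
Qed.

(** Relabeling is a bijection on words, so only the word pulled back along an inverse of [s]
    contributes. *)
Lemma top_coef_transport A s T w' : {in A &, injective s} -> rel_on A T ->
  is_irr_word (fimage s A) w' ->
  top_coef K (fimage s A) (transport s T) w' =
    \sum_(w \in words num_irreducible A)
      top_coef K A T w * cot_act (irr_act K) s w w'.
Proof.
move=> injs TA ww'; have [t st ts] := exists_inverse injs.
have EA : fimage t (fimage s A) = A.
  by rewrite -fimage_comp -[RHS]fimage_id; apply: eq_in_fimage.
have actE w : is_irr_word A w ->
    cot_act (irr_act K) s w w' = (map (map_letter s) w == w')%:R.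
  move=> ww; apply: cot_actE.
  - by move=> l lw; exact: subset_inj (is_irr_word_sub ww lw) injs.
  - by have [] := (is_irr_wordP _ _).1 ww.
  - by have [] := (is_irr_wordP _ _).1 ww'.
pose w0 := map (map_letter t) w'.
have ww0 : is_irr_word A w0.
  by rewrite -{1}EA; apply: is_irr_word_map ww'; apply: can_in_inj ts.
have sw0 : map (map_letter s) w0 = w'.
  rewrite -map_comp -[RHS]map_id; apply/eq_in_map => l lw /=.
  apply: map_letterK; last exact: is_irr_word_valid ww' lw.
  by move=> x xl; apply: ts; exact: fsubsetP (is_irr_word_sub ww' lw) _ xl.
rewrite (@fsbig_only1 _ _ _ w0) //.
  by rewrite actE // sw0 eqxx mulr1 -{1}sw0 top_coef_map.
move=> w ww nw; rewrite actE //; case: eqP => [E|]; last by rewrite mulr0.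
case: nw; rewrite /w0 -E -map_comp -[LHS]map_id; apply/eq_in_map => l lw /=.
apply/esym/map_letterK; last exact: is_irr_word_valid ww lw.
by move=> x xl; apply: st; exact: fsubsetP (is_irr_word_sub ww lw) _ xl.
Qed.

End Morphism.

(** * Ordinal sums *)

(** Independent rows give [#|X| <= #|Y|], so the matrix is square and invertible. The inverse of f
    is thus obtained by counting, without a formula for it. *)
Lemma exists_inverse_family (K : fieldType) (I J : choiceType) (i0 : I) (j0 : J)
    (X : {fset I}) (Y : {fset J}) (F : I -> J -> K) :
  (#|` Y| <= #|` X|)%N ->
  (forall h : I -> K, (forall j, j \in Y -> \sum_(i <- X) h i * F i j = 0) ->
     forall i, i \in X -> h i = 0) ->
  exists G : J -> I -> K,
    [/\ forall j i, G j i != 0 -> i \in X,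
        {in X &, forall i i', \sum_(j <- Y) F i j * G j i' = (i == i')%:R} &
        {in Y &, forall j j', \sum_(i <- X) G j i * F i j' = (j == j')%:R}].
Proof.
move=> YX free; pose xs := enum_fset X; pose ys := enum_fset Y.
pose M := \matrix_(a < #|` X|, b < #|` Y|) F (nth i0 xs a) (nth j0 ys b).
have sumX (f : I -> K) : \sum_(i <- X) f i = \sum_(a < #|` X|) f (nth i0 xs a).
  by rewrite (big_nth i0) big_mkord.
have sumY (f : J -> K) : \sum_(j <- Y) f j = \sum_(b < #|` Y|) f (nth j0 ys b).
  by rewrite (big_nth j0) big_mkord.
have idX i : i \in X -> {a : 'I_#|` X| | nth i0 xs a = i & index i xs = a}.
  move=> iX; have ltiX : (index i xs < #|` X|)%N by rewrite index_mem.
  by exists (Ordinal ltiX); rewrite //= nth_index.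
have idY j : j \in Y -> {b : 'I_#|` Y| | nth j0 ys b = j & index j ys = b}.
  move=> jY; have ltjY : (index j ys < #|` Y|)%N by rewrite index_mem.
  by exists (Ordinal ltjY); rewrite //= nth_index.
have nthX (a : 'I_#|` X|) : index (nth i0 xs a) xs = a.
  by rewrite index_uniq ?fset_uniq.
have nthY (b : 'I_#|` Y|) : index (nth j0 ys b) ys = b.
  by rewrite index_uniq ?fset_uniq.
have freeM : row_free M.
  apply: inj_row_free => v vM; apply/rowP => a; rewrite mxE.
  (* [h] extends the row vector [v] by zero outside [X]. *)
  pose h i := if insub (index i xs) is Some a' then v 0 a' else 0.
  have hE (a' : 'I_#|` X|) : h (nth i0 xs a') = v 0 a'.
    by rewrite /h nthX valK.
  rewrite -hE; apply: free; last exact: mem_nth.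
  move=> j /idY[b <- _]; rewrite sumX.
  transitivity ((v *m M) 0 b); last by rewrite vM mxE.
  by rewrite mxE; apply: eq_bigr => a' _; rewrite hE mxE.
have eqXY : #|` X| = #|` Y|.
  apply/eqP; rewrite eqn_leq YX andbT -(eqP freeM); exact: rank_leq_col.
have fullM : row_full M by rewrite /row_full (eqP freeM) eqXY.
have [N MN] := row_freeP freeM; have [N' N'M] := row_fullP fullM.
have NM : N *m M = 1%:M.
  have <- : N' = N by rewrite -[N']mulmx1 -MN mulmxA N'M mul1mx.
  exact: N'M.
pose G j i := if insub (index j ys) is Some b then
                if insub (index i xs) is Some a then N b a else 0 else 0.
have GE (b : 'I_#|` Y|) (a : 'I_#|` X|) : G (nth j0 ys b) (nth i0 xs a) = N b a.
  by rewrite /G nthX nthY !valK.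
exists G; split.
- move=> j i; rewrite /G; case: insubP => [b _ _|_]; last by rewrite eqxx.
  by case: insubP => [a + _|_]; rewrite ?index_mem ?eqxx.
- move=> i i' /idX[a <- _] /idX[a' <- _]; rewrite sumY.
  transitivity ((M *m N) a a').
    by rewrite mxE; apply: eq_bigr => b _; rewrite GE mxE.
  by rewrite MN mxE nth_uniq ?fset_uniq.
move=> j j' /idY[b <- _] /idY[b' <- _]; rewrite sumX.
transitivity ((N *m M) b b').
  by rewrite mxE; apply: eq_bigr => a _; rewrite GE mxE.
by rewrite NM mxE nth_uniq ?fset_uniq.
Qed.

(** The first letter is placed lowest, so that suffixes are open, as in the coproduct. *)
Fixpoint ordinal_sum w : {fset (nat * nat)} :=
  if w is l :: w' then
    topology_of l `|` (l.1 `*` support w' `|` ordinal_sum w')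
  else fset0.

Lemma ordinal_sumP A l w : is_irr_word A (l :: w) ->
  rel_on (A `\` l.1) (ordinal_sum w) ->
  [/\ forall x y, x \in l.1 -> y \in A `\` l.1 ->
        (x, y) \in ordinal_sum (l :: w) /\ (y, x) \notin ordinal_sum (l :: w),
      restr (ordinal_sum (l :: w)) l.1 = topology_of l &
      restr (ordinal_sum (l :: w)) (A `\` l.1) = ordinal_sum w].
Proof.
move=> /is_irr_word_cons[vl lA [_ _ /= sw]] on; have lon := topology_of_on l.
have {}sw : support w = A `\` l.1 by [].
have dl : [disjoint l.1 & A `\` l.1]%fset.
  by apply/fdisjointP => x xl; rewrite in_fsetD xl.
have dl' : [disjoint A `\` l.1 & l.1]%fset by rewrite fdisjoint_sym.
rewrite /= sw; split.
- move=> x y xl yA; rewrite !in_fsetU !in_fsetM /= xl yA orbT; split=> //.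
  have yl : (y \in l.1) = false by move: yA; rewrite in_fsetD => /andP[/negPf].
  rewrite yl /= negb_or; apply/andP; split.
    by apply/negP => /(rel_onP _ _ lon)[]; rewrite yl.
  by apply/negP => /(rel_onP _ _ on)[_]; rewrite in_fsetD xl.
- rewrite restrU restr_id // restrU (restr_disj on dl) fsetU0.
  apply/fsetUidPl/fsubsetP => -[x y]; rewrite in_restr in_fsetM in_fsetD /=.
  by case/and3P=> /andP[_ /andP[/negP yl _]] _ /yl.
rewrite restrU (restr_disj lon dl') fset0U restrU [X in _ `|` X]restr_id //.
apply/fsetUidPr/fsubsetP => -[x y]; rewrite in_restr in_fsetM in_fsetD /=.
by case/and3P=> /andP[xl _]; rewrite in_fsetD xl.
Qed.

Lemma ordinal_sum_topology A w : is_irr_word A w -> is_topology A (ordinal_sum w).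
Proof.
elim: w A => [|l w IH] A.
  by move=> /is_irr_word0 ->; split => // ? ? ?; rewrite in_fset0.
move=> lw; have [vl lA wA] := (is_irr_word_cons _ _ _).1 lw.
have tS := IH _ wA; have on := topology_rel_on tS.
have [_ rS cS] := tS; have [_ rl cl] := irreducible_topology (valid_irreducible vl).
have lon := rel_onP _ _ (topology_of_on l).
have [_ _ /= sw] := wA; have {}sw : support w = A `\` l.1 by [].
have memS x y : (x, y) \in ordinal_sum (l :: w) <->
    [\/ (x, y) \in topology_of l, x \in l.1 /\ y \in A `\` l.1 |
        (x, y) \in ordinal_sum w].
  rewrite /= !in_fsetU in_fsetM /= sw.
  split=> [/or3P[->|/andP[-> ->]|->]|[->|[-> ->]|->]]; rewrite ?orbT //.
  - exact: Or31.
  - exact: Or32.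
  - exact: Or33.
have {}on := rel_onP _ _ on.
have AlP x : x \in A `\` l.1 -> x \in A /\ ~ x \in l.1.
  by rewrite in_fsetD => /andP[/negP].
split.
- move=> [x y] /memS /=[/lon[xl yl]|[xl /AlP[-> _]]|/on[/AlP[-> _] /AlP[-> _]]] //.
    by rewrite !(fsubsetP lA).
  by rewrite !(fsubsetP lA).
- move=> x xA; apply/memS; have [xl|xl] := boolP (x \in l.1).
    by apply: Or31; apply: rl.
  by apply: Or33; apply: rS; rewrite in_fsetD xl.
(* Going up, one leaves the first letter at most once and never returns to it. *)
move=> x y z /memS xy /memS yz; apply/memS; case: xy => [xy|[xl yA]|xy].
- have [xl yl] := lon _ _ xy; case: yz => [yz|[_ zA]|/on[/AlP[_]]] //.
    by apply: Or31; apply: cl yz.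
  exact: Or32.
- case: yz => [/lon[yl]|[yl]|yz]; try by have [_] := AlP _ yA.
  by apply: Or32; have [] := on _ _ yz.
have [xA yA] := on _ _ xy.
case: yz => [/lon[yl]|[yl]|yz]; try by have [_] := AlP _ yA.
by apply: Or33; apply: cS yz.
Qed.

Lemma ordinal_sum_on A w : is_irr_word A w -> rel_on A (ordinal_sum w).
Proof. by move/ordinal_sum_topology/topology_rel_on. Qed.

(* Two initial segments of an ordinal sum are nested, so the first irreducible
   summand is determined. *)
Lemma first_letter_sub A T B C :
  B `<=` A -> C `<=` A -> C != fset0 ->
  (forall x y, x \in B -> y \in A `\` B -> (x, y) \in T /\ (y, x) \notin T) ->
  (forall x y, x \in C -> y \in A `\` C -> (x, y) \in T /\ (y, x) \notin T) ->
  irreducible B (restr T B) -> B `<=` C.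
Proof.
move=> /fsubsetP BA /fsubsetP CA C0 spB spC [_ _ irrB].
apply/negPn/negP => /fsubsetPn[x xB xC].
have CB : C `<=` B.
  apply/fsubsetP => y yC; apply/negPn/negP => yB.
  have [xy _] : (x, y) \in T /\ (y, x) \notin T.
    by apply: spB; rewrite // in_fsetD yB CA.
  have [_ /negP] : (y, x) \in T /\ (x, y) \notin T.
    by apply: spC; rewrite // in_fsetD xC BA.
  by apply.
apply: (irrB C); split=> //; first by apply: contraNneq xC => ->.
move=> y z yC; rewrite in_fsetD => /andP[zC zB].
rewrite !in_restr /= zB (fsubsetP CB _ yC) !andbT; apply: spC => //.
by rewrite in_fsetD zC BA.
Qed.

(** Comparing the two first blocks in both directions shows that they are equal; the restrictions to
    this block and to its complement then give the first letter and the rest. *)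
Lemma ordinal_sum_inj A : {in words num_irreducible A &, injective ordinal_sum}.
Proof.
move=> w w' /set_mem wA /set_mem w'A.
elim: w w' A wA w'A => [|l w IH] [|l' w'] A //.
- move=> /is_irr_word0 -> /is_irr_word_cons[/andP[l0 _]].
  by rewrite fsubset0 (negPf l0).
- move=> + /is_irr_word0 A0; rewrite A0 => /is_irr_word_cons[/andP[l0 _]].
  by rewrite fsubset0 (negPf l0).
move=> lw lw' E.
have [vl lA wA] := (is_irr_word_cons _ _ _).1 lw.
have [vl' lA' wA'] := (is_irr_word_cons _ _ _).1 lw'.
have [spl rl rw] := ordinal_sumP lw (ordinal_sum_on wA).
have [spl' rl' rw'] := ordinal_sumP lw' (ordinal_sum_on wA').
rewrite -E in spl' rl' rw'.
have [l0 l0'] : l.1 != fset0 /\ l'.1 != fset0 by case/andP: vl; case/andP: vl'.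
have irr := valid_irreducible vl; have irr' := valid_irreducible vl'.
have El : l.1 = l'.1.
  apply/eqP; rewrite eqEfsubset; apply/andP; split.
    by apply: (first_letter_sub lA lA' l0' spl spl'); rewrite rl.
  by apply: (first_letter_sub lA' lA l0 spl' spl); rewrite rl'.
have -> : l = l'.
  apply: topology_of_inj => //; first by case/andP: vl.
    by case/andP: vl'.
  by rewrite -rl -rl' El.
congr (_ :: _); apply: (IH _ (A `\` l.1)) => //; first by rewrite El.
by rewrite -rw -rw' El.
Qed.

(** Finiteness has to precede the count, since [fset_set] of an infinite set is only a default
    value. *)
Lemma finite_words A : finite_set (words num_irreducible A).
Proof.
rewrite -(eq_finite_set (inj_card_eq (@ordinal_sum_inj A))).
apply: sub_finite_set (finite_fset (topologies_on A)) => T [w wA <-] /=.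
exact/topologies_onP/ordinal_sum_topology.
Qed.

Lemma card_words A :
  (#|` fset_set (words num_irreducible A)| <= #|` topologies_on A|)%N.
Proof.
have <- : #|` [fset ordinal_sum w | w in fset_set (words num_irreducible A)]|
          = #|` fset_set (words num_irreducible A)|.
  apply: card_in_imfset => w w' /=; rewrite !in_fset_set; try exact: finite_words.
  exact: ordinal_sum_inj.
apply/fsubset_leq_card/fsubsetP => T /imfsetP[w /=].
rewrite in_fset_set; last exact: finite_words.
by move=> /set_mem wA ->; apply/topologies_onP/ordinal_sum_topology.
Qed.

(** * Injectivity *)

Section Freeness.
Variable K : fieldType.
Hypothesis charK0 : [pchar K] =i pred0.

(** Pairing the pushforward of [h] with a form: this passes between the coordinates of an element
    and those of its coproduct. *)
Lemma sum_fibers (I J : choiceType) (X : {fset I}) (Y : {fset J}) (P : pred I)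
    (h : I -> K) (a : I -> J) (G : J -> K) :
  {in X, forall i, P i -> a i \in Y} ->
  \sum_(c <- Y) (\sum_(i <- X | P i && (a i == c)) h i) * G c =
  \sum_(i <- X | P i) h i * G (a i).
Proof.
move=> aY; under eq_bigr do rewrite big_distrl big_mkcond /=.
rewrite exchange_big [RHS]big_mkcond; apply: eq_fbigr => i iX _ /=.
case: ifP => Pi; last by rewrite big1.
rewrite (bigD1_seq (a i)) ?fset_uniq ?aY //= eqxx big1 ?addr0 // => c nc.
by rewrite eq_sym (negPf nc).
Qed.

(* An element [h] killed by f has all its coproducts killed by f (x) f, hence
   is primitive by induction, so that one-letter words read off #|A| times its
   irreducible coordinates. If its irreducible coordinates vanish and [T] is
   split by [B], then [T] is the largest topology with its restrictions to [B]
   and [A `\` B] for which [A `\` B] is open, so that the coproduct expresses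
   [h T] in terms of the coordinates at smaller topologies. *)
Lemma top_coef_free A (h : {fset (nat * nat)} -> K) :
  (forall w, is_irr_word A w ->
     \sum_(T <- topologies_on A) h T * top_coef K A T w = 0) ->
  forall T, is_topology A T -> h T = 0.
Proof.
have [n] := ubnP #|` A|; elim: n => // n IH in A h * => An h0.
have [A0|A0] := eqVneq A fset0.
  rewrite {}A0 in h0 *.
  have sub0 T : is_topology fset0 T -> T = fset0.
    move=> /topology_rel_on/rel_onP T0; apply/eqP; rewrite -fsubset0.
    by apply/fsubsetP => -[x y] /T0[].
  have top0 : topologies_on fset0 = [fset fset0].
    apply/fsetP => S; rewrite in_fset1; apply/topologies_onP/eqP => [/sub0 //|->].
    by split=> // ? ? ?; rewrite in_fset0.
  move=> T /sub0 ->; have := h0 [::] ((is_irr_word0 _).2 erefl).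
  by rewrite top0 big_seq_fset1 top_coef_nil mulr1.
have prim B S1 S2 : B `<=` A -> B != fset0 -> B != A ->
    \sum_(T <- topologies_on A | `[< is_open T B >] &&
       (restr T (A `\` B) == S1) && (restr T B == S2)) h T = 0.
  move=> BA B0 nBA.
  have AB : [disjoint A `\` B & B]%fset.
    by apply/fdisjointP => x; rewrite in_fsetD => /andP[].
  have EAB : (A `\` B) `|` B = A.
    apply/fsetP => x; rewrite in_fsetU in_fsetD orbC orb_andr orbN.
    by apply/orP/idP => [[/(fsubsetP BA)//|//]|->]; right.
  have ltB : (#|` B| < n)%N.
    by rewrite -ltnS (leq_trans _ An) // ltnS proper_card ?fpowersetE.
  have ltAB : (#|` A `\` B| < n)%N.
    rewrite -ltnS (leq_trans _ An) // ltnS proper_card ?fpowersetE ?fsubsetDl //.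
    apply: contraNneq B0 => /fsetDidPl; rewrite fdisjoint_sym => /fdisjointP dBA.
    rewrite -fsubset0; apply/fsubsetP => x xB.
    by have := dBA x xB; rewrite (fsubsetP BA).
  have resB : {in topologies_on A, forall T, restr T B \in topologies_on B}.
    by move=> T /topologies_onP tT; apply/topologies_onP/(topology_restr tT).
  have resAB : {in topologies_on A, forall T,
      restr T (A `\` B) \in topologies_on (A `\` B)}.
    move=> T /topologies_onP tT; apply/topologies_onP/(topology_restr tT).
    exact: fsubsetDl.
  have [t1|nt1] := boolP (S1 \in topologies_on (A `\` B)); last first.
    rewrite big1_fset // => T TA /andP[/andP[_ /eqP E] _].
    by case/negP: nt1; rewrite -E resAB.
  have [t2|nt2] := boolP (S2 \in topologies_on B); last first.
    rewrite big1_fset // => T TA /andP[_ /eqP E].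
    by case/negP: nt2; rewrite -E resB.
  under eq_bigl do rewrite andbAC.
  (* Injectivity of f (x) f is proved one factor at a time: induction on the complement of [B]
     brings in a word [w1], induction on [B] a word [w2], and the resulting double pairing is that
     of [h] with [w1 ++ w2]. *)
  move/topologies_onP: t1; apply: (IH (A `\` B) (fun S1 =>
    \sum_(T <- topologies_on A | `[< is_open T B >] && (restr T B == S2) &&
       (restr T (A `\` B) == S1)) h T)) => // w1 ww1.
  rewrite (@sum_fibers _ _ _ _ (fun T => `[< is_open T B >] && (restr T B == S2))
    h (fun T => restr T (A `\` B)) (fun S => top_coef K (A `\` B) S w1)); last first.
    by move=> T TA _; apply: resAB.
  move/topologies_onP: t2; apply: (IH B (fun S2 =>
    \sum_(T <- topologies_on A | `[< is_open T B >] && (restr T B == S2))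
       h T * top_coef K (A `\` B) (restr T (A `\` B)) w1)) => // w2 ww2.
  rewrite (@sum_fibers _ _ _ _ (fun T => `[< is_open T B >])
    (fun T => h T * top_coef K (A `\` B) (restr T (A `\` B)) w1)
    (fun T => restr T B) (fun S => top_coef K B S w2)); last first.
    by move=> T TA _; apply: resB.
  rewrite -[RHS](h0 (w1 ++ w2)); last first.
    by rewrite -EAB; apply: is_irr_word_cat.
  rewrite big_mkcond; apply: eq_fbigr => T /topologies_onP/topology_rel_on TA _.
  rewrite -[X in top_coef K X T _]EAB top_coef_cat ?EAB //.
  by case: ifP; rewrite ?mulr0 // mulrA.
have hirr S : irreducible A S -> h S = 0.
  move=> irrS; have ww : is_irr_word A [:: letter_of A S].
    apply/is_irr_word_cons; split; first exact: irreducible_valid.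
      exact: fsubset_refl.
    by apply/is_irr_word0; rewrite fsetDv.
  have : #|` A|%:R * h S = 0.
    rewrite -(h0 _ ww); transitivity
        (\sum_(T <- topologies_on A) h T * Dynkin A T (fun S' => (S' == S)%:R)).
      rewrite sum_Dynkin_primitive //; congr (_ * _).
      have SA : S \in topologies_on A by apply/topologies_onP/irreducible_topology.
      rewrite (bigD1_seq S) ?fset_uniq //= eqxx mulr1 big1 ?addr0 // => T nT.
      by rewrite (negPf nT) mulr0.
    apply: eq_fbigr => T /topologies_onP/topology_rel_on TA _.
    by rewrite top_coefE // mul1r big_seq1 /letter_coef restr_id // letter_ofK.
  (* Characteristic 0 enters here: [A] is nonempty, so its cardinality is invertible in [K]. *)
  move/eqP; rewrite mulf_eq0 ((pcharf0P _).1 charK0) cardfs_eq0 (negPf A0).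
  by move/eqP.
move=> T; have [m] := ubnP #|` T|; elim: m => // m IHm in T * => Tm tT.
have [irr|nirr] := pselect (irreducible A T); first exact: hirr.
have [B [BA B0 nBA sp]] : exists B, splits A T B.
  apply: contrapT => nsp; apply: nirr; split=> // B sp.
  by apply: nsp; exists B.
have TA := topology_rel_on tT.
have spD x y : x \in B -> y \in A `\` B -> (x, y) \in T /\ (y, x) \notin T.
  exact: sp.
have EB : A `\` (A `\` B) = B by rewrite fsetDK.
have nAB0 : A `\` B != fset0.
  by rewrite fsetD_eq0; apply: contraNN nBA => AB; rewrite eqEfsubset BA.
have nABA : A `\` B != A.
  by apply: contraNneq B0 => E; rewrite -EB E fsetDv.
have := prim _ (restr T B) (restr T (A `\` B)) (fsubsetDl _ _) nAB0 nABA.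
rewrite EB big_mkcond (bigD1_seq T) ?fset_uniq //=; last exact/topologies_onP.
have oT : is_open T (A `\` B).
  move=> x y xy xA; have [_ yA] := rel_onP _ _ TA _ _ xy.
  rewrite in_fsetD yA andbT; apply/negP => yB.
  by have [_] := spD _ _ yB xA; rewrite xy.
rewrite asboolT // !eqxx big_seq_cond big1 ?addr0 // => T0 /andP[].
move=> /topologies_onP tT0 nT; case: ifP => //.
move=> /andP[/andP[/asboolP oT0 /eqP eB] /eqP eAB].
apply: IHm => //; rewrite -ltnS; apply: leq_trans Tm; rewrite ltnS.
(* [T0] agrees with [T] on both blocks, [T] has all pairs from [B] to its complement, and openness
   forbids [T0] any pair in the other direction. *)
apply: fproper_ltn_card; rewrite fproperEneq nT /=; apply/fsubsetP => -[x y] xy.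
have [xA yA] := rel_onP _ _ (topology_rel_on tT0) _ _ xy.
have sub C : x \in C -> y \in C -> restr T0 C = restr T C -> (x, y) \in T.
  move=> xC yC E; have : (x, y) \in restr T0 C by rewrite in_restr xy xC.
  by rewrite E in_restr => /and3P[].
have [xB|xB] := boolP (x \in B); have [yB|yB] := boolP (y \in B).
- exact: sub eB.
- by have [] := spD x y xB; rewrite // in_fsetD yB.
- have := oT0 _ _ xy; rewrite !in_fsetD xB xA yB /= => /(_ isT).
  by [].
by apply: sub eAB; rewrite in_fsetD ?xB ?yB.
Qed.

End Freeness.

Theorem theorem42 (K : fieldType) (charK0 : [pchar K]%R =i pred0) :
  exists (d : nat -> nat) (rho : {fset nat} -> (nat -> nat) -> nat -> nat -> K)
         (f : {fset nat} -> {fset (nat * nat)} -> word -> K),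
    is_species d rho /\ top_cot_iso d rho f.
Proof.
exists num_irreducible, (irr_act K), (top_coef K).
split; first exact: irr_act_species.
split; first by move=> A T w _; apply: top_coef_supp.
have sumW A (F : word -> K) : \sum_(w \in words num_irreducible A) F w =
    \sum_(w <- fset_set (words num_irreducible A)) F w.
  by apply: fsbig_finite; apply: finite_words.
have sumT A (F : {fset (nat * nat)} -> K) :
    \sum_(T \in topologies A) F T = \sum_(T <- topologies_on A) F T.
  rewrite [RHS]fsbig_seq ?fset_uniq //; apply: eq_fsbigl.
  by apply/seteqP; split=> T /topologies_onP.
have memW A w : w \in fset_set (words num_irreducible A) <-> is_irr_word A w.
  rewrite in_fset_set; last exact: finite_words.
  by split=> [/set_mem|/mem_set].
split.
- have inv A := exists_inverse_family fset0 [::] (card_words A)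
    (fun h hw T => fun tT => @top_coef_free K charK0 A h
       (fun w ww => hw w ((memW A w).2 ww)) T (elimT (topologies_onP A T) tT)).
  (* The inverse of a natural isomorphism is natural, so an arbitrary choice for each [A] is
     enough. *)
  have [g gP] := choice inv; exists g; split.
  + by move=> A w T _; have [gT _ _] := gP A; move=> /gT/topologies_onP.
  + move=> A T T' /topologies_onP tT /topologies_onP tT'.
    by rewrite sumW; have [_ -> //] := gP A.
  move=> A w w' /memW ww /memW ww'.
  by rewrite sumT; have [_ _ -> //] := gP A.
- move=> A s T w' injs /topology_rel_on TA ww'.
  exact: top_coef_transport.
- move=> A B T1 T2 w AB /topology_rel_on T1A /topology_rel_on T2B ww.
  exact: top_coefU.
- move=> A B T w1 w2 AB /topology_rel_on TAB ww1 ww2.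
  exact: top_coef_cat.
exact: top_coef_nil.
Qed.
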